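(* Let $(b,c)$ be a graph over $(X,m)$ with $m=n$ and $c\equiv0$, where $n(x)=\sum_{y\in X}b(x,y)$, and assume that its Cheeger constant at infinity satisfies $\alpha_\infty=1$. Then $\sigma(L_p)=\sigma(L_2)$ for all $p\in(1,\infty)$, and the graph has superexponential volume growth with respect to the natural graph metric, i.e., $$\lim_{r\to\infty}\frac1r\log n(B_r(x))=\infty\quad\text{for all }x\in X.$$
   Context: Graphs. $X$ is a countable set with the discrete topology, $m:X\to(0,\infty)$, $m(A)=\sum_{x\in A}m(x)$ and $n(A)=\sum_{x\in A}n(x)$ for $A\subseteq X$. A graph over $(X,m)$ is a pair $(b,c)$ with $c:X\to[0,\infty)$ and $b:X\times X\to[0,\infty)$ symmetric, with zero diagonal, and $\sum_{y\in X}b(x,y)<\infty$ for all $x\in X$. Write $x\sim y$ if $b(x,y)>0$. It is assumed that every vertex $x$ has some $y\sim x$. The natural graph metric $d_n$ is the path metric giving every edge $x\sim y$ length $1$, that is, $d_n(x,y)$ is the infimum of the number of edges over all paths from $x$ to $y$, and $B_r(x)=\{y\in X:d_n(x,y)\le r\}$. If $n(B_r(x))=\infty$, then $\log n(B_r(x))$ is read as $\infty$. Cheeger constant at infinity. $\alpha_\infty\ge0$ is the supremum of all $\beta\ge0$ for which there exists a finite set $K\subseteq X$ such that $\beta\,n(W)\le|\partial W|$ for all finite $W\subseteq X\setminus K$, where $|\partial W|:=\sum_{(x,y)\in W\times(X\setminus W)}b(x,y)$. Operators. $\ell^p=\ell^p(X,m)$ are the complex $\ell^p$-spaces with norms $\|f\|_p=(\sum_{x\in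 X}|f(x)|^pm(x))^{1/p}$, $p\in[1,\infty)$. $C_c(X)$ is the space of finitely supported complex functions on $X$. Let $$Q(f,g)=\frac12\sum_{x,y\in X}b(x,y)(f(x)-f(y))\overline{(g(x)-g(y))}+\sum_{x\in X}c(x)f(x)\overline{g(x)},$$ with domain $D(Q)$ the closure of $C_c(X)$ with respect to $\|f\|_Q=(Q(f,f)+\|f\|_2^2)^{1/2}$, and let $L=L_2$ be the associated positive selfadjoint operator on $\ell^2(X,m)$. The semigroup $T_t=e^{-tL}$, $t\ge0$, extends consistently to strongly continuous contraction semigroups on $\ell^p$, $p\in[1,\infty)$, and $L_p$ denotes the positive generator on $\ell^p$, i.e. $T_t=e^{-tL_p}$. For $m=n$ and $c\equiv0$ (the normalized Laplacian) the $L_p$ are bounded operators acting as $L_pf(x)=\frac1{n(x)}\sum_{y\in X}b(x,y)(f(x)-f(y))$. $\sigma(L_p)$ is the spectrum of $L_p$ on $\ell^p$.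
   Formalization: The volume growth limit is claimed only for those x whose connected component has infinite volume n; without this it fails, e.g. on the half-line with b(k,k+1)=4^(-k^2), where α∞=1 but n(X) is finite. The spectral claim is unchanged. *)

(* Defs.v *)
From HB Require Import structures.
From mathcomp Require Import all_boot all_order all_algebra.
From mathcomp Require Import all_classical all_reals all_analysis.
From mathcomp.real_closed Require Import complex.
Import Order.TTheory GRing.Theory Num.Theory.
Import numFieldNormedType.Exports.

Set Implicit Arguments.
Unset Strict Implicit.
Unset Printing Implicit Defensive.

Local Open Scope classical_set_scope.
Local Open Scope ring_scope.

(* The vertex measure [m] is a parameter of the graph; its positivity is a
   separate hypothesis. *)
Record graph (R : realType) (X : countType) (m : X -> R) := Graph {
  edge_weight : X -> X -> R;
  killing : X -> R;
  edge_weight_ge0 : forall x y, 0 <= edge_weight x y;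
  edge_weight_sym : forall x y, edge_weight x y = edge_weight y x;
  edge_weight_diag : forall x, edge_weight x x = 0;
  edge_weight_summable :
    forall x, (\esum_(y in [set: X]) (edge_weight x y)%:E < +oo)%E;
  killing_ge0 : forall x, 0 <= killing x }.

Section Geometry.
Variables (R : realType) (X : countType) (m : X -> R) (G : graph m).

Definition adj : rel X := fun x y => 0 < edge_weight G x y.

(* n(x) and n(A), valued in the extended reals; n(x) is always finite. *)
Definition deg (x : X) : \bar R :=
  \esum_(y in [set: X]) (edge_weight G x y)%:E.

Definition deg_vol (A : set X) : \bar R := \esum_(x in A) deg x.

Definition boundary (W : set X) : \bar R :=
  \esum_(e in W `*` ~` W) (edge_weight G e.1 e.2)%:E.

(* The supremum is taken in the extended reals: for finite [X] one may take
   [K] to be all of [X], so every [beta] is admissible and the value is +oo. *)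
Definition cheeger_infty : \bar R :=
  ereal_sup [set beta%:E | beta in [set beta : R | 0 <= beta /\
    exists K : set X, finite_set K /\
      forall W : set X, finite_set W -> W `<=` ~` K ->
        (beta%:E * deg_vol W <= boundary W)%E]].

(* Number of edges of a shortest path; +oo if there is no path. *)
Definition graph_dist (x y : X) : \bar R :=
  ereal_inf [set (size s)%:R%:E | s in
    [set s : seq X | path adj x s /\ last x s = y]].

Definition graph_ball (x : X) (r : R) : set X :=
  [set y | (graph_dist x y <= r%:E)%E].

(* Volume growth at [x] only sees the connected component of [x]. Cheeger
   constant 1 at infinity does not force n(component x) to be infinite: on the
   half-line with b(k, k+1) = 4^(-k^2) one has n(X) < +oo and Cheeger constant
   1 at infinity, and n(B_r(x)) is then bounded in r. *)
Definition component (x : X) : set X := [set y | (graph_dist x y < +oo)%E].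

End Geometry.

Section Operators.
Variables (R : realType) (X : countType).
Local Notation C := R[i].

(* Sums of absolutely summable families. The library's [esum] is only
   meaningful for nonnegative families, hence the splitting into positive and
   negative, real and imaginary parts. *)
Definition real_sum (f : X -> R) : R :=
  fine (\esum_(x in [set: X]) (Num.max (f x) 0)%:E) -
  fine (\esum_(x in [set: X]) (Num.max (- f x) 0)%:E).

Definition complex_sum (f : X -> C) : C :=
  Complex (real_sum (fun x => complex.Re (f x)))
          (real_sum (fun x => complex.Im (f x))).

Definition lp_mass (m : X -> R) (p : R) (f : X -> C) : \bar R :=
  \esum_(x in [set: X]) (Normc.normc (f x) `^ p * m x)%:E.

Definition lp (m : X -> R) (p : R) : set (X -> C) :=
  [set f | (lp_mass m p f < +oo)%E].

Definition lp_norm (m : X -> R) (p : R) (f : X -> C) : R :=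
  fine (lp_mass m p f) `^ p^-1.

(* An operator on l^p is represented by a map on all functions, of which only
   the restriction to l^p matters. *)
Definition bounded_operator (m : X -> R) (p : R)
    (S : (X -> C) -> (X -> C)) : Prop :=
  [/\ forall f, lp m p f -> lp m p (S f),
      forall (a : C) f g, lp m p f -> lp m p g ->
        S (fun x => a * f x + g x) = (fun x => a * S f x + S g x) &
      exists K : R, forall f, lp m p f ->
        lp_norm m p (S f) <= K * lp_norm m p f].

(* Resolvent set and spectrum on l^p of an everywhere defined operator [A]. *)
Definition resolvent_set (m : X -> R) (p : R)
    (A : (X -> C) -> (X -> C)) : set C :=
  [set z | exists2 S, bounded_operator m p S &
    forall f, lp m p f ->
      S (fun x => z * f x - A f x) = f /\
      (fun x => z * S f x - A (S f) x) = f].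

Definition spectrum (m : X -> R) (p : R)
    (A : (X -> C) -> (X -> C)) : set C := ~` resolvent_set m p A.

(* The weighted graph Laplacian. When [m] is the degree [n] and the killing
   term vanishes, it is
     f |-> (x |-> n(x)^-1 * \sum_y b(x,y) (f x - f y)),
   which maps each l^p boundedly into itself; its restriction to l^p is then
   the generator L_p of the heat semigroup on l^p. *)
Definition laplacian (m : X -> R) (G : graph m) (f : X -> C) : X -> C :=
  fun x => real_complex R (m x)^-1 *
    (complex_sum (fun y => real_complex R (edge_weight G x y) * (f x - f y)) +
     real_complex R (killing G x) * f x).

Definition laplacian_spectrum (m : X -> R) (G : graph m) (p : R) : set C :=
  spectrum m p (laplacian G).

End Operators.

(* Main.v *)
Require Import Defs.
From mathcomp Require Import all_boot all_order all_algebra.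
From mathcomp Require Import all_classical all_reals all_analysis.
From mathcomp.real_closed Require Import complex.
From mathcomp Require Import finmap ring lra.
Import Order.TTheory GRing.Theory Num.Theory.
Import numFieldNormedType.Exports.
Local Open Scope classical_set_scope.
Local Open Scope ring_scope.

(** Write [P = 1 - L] for the averaging operator of the graph, so that [z - L] is
    the negative of [lambda - P] with [lambda = 1 - z].

    The hypothesis on the Cheeger constant says that, given [eta > 0], there is a
    finite set [K] such that any finite set outside [K] is joined to itself by at
    most the fraction [eta] of its volume. Cutting a function into layers turns
    this into a co-area inequality for [min (H x) (H y)] ([coarea_finite]), and
    an elementary inequality for powers turns the latter into smallness of the
    norm of the compression of [P] to the complement of [K], in all [l^p] with
    [1 < p] by the same argument ([mass_avg_small]). So [P] is a finite rank
    perturbation of an operator of arbitrarily small norm.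

    For [lambda <> 0] and two exponents [p], [r], choose [K] such that the
    compression has small norm relative to [lambda] for both. Its resolvent
    is then a Neumann series, the same for both exponents. Hence a solution in
    [l^p] of [lambda f - P f = g] with [g] in [l^r] lies in [l^r]
    ([shifted_regularity]). So injectivity on one space gives injectivity on the
    other. As for surjectivity, the Neumann series solves the equation up to an
    error supported on [K], and the finitely many solutions needed to correct it
    exist in [l^p], hence in [l^r] ([solve_all]). This makes [lambda - P]
    boundedly invertible on both spaces or on neither. For [lambda = 0] it is
    invertible on none: point masses far out have small averages
    ([small_average]).

    For the growth, all edges from [B_n] end in [B_(n+1)], so that outside [K] the
    volume of [B_n] is at most the volume of [K] plus [eta] times that of
    [B_(n+1)] ([outer_step]). Once the volume of the balls exceeds a multiple of
    that of [K], it grows at least by the factor [1 / (2 eta)] with each step, and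
    [eta] is arbitrary. *)

Set Implicit Arguments.
Unset Strict Implicit.
Unset Printing Implicit Defensive.


(** * Nonnegative and real families *)

Section Sums.
Variable R : realType.
Local Open Scope ereal_scope.

Definition tsum (I : choiceType) (a : I -> R) : \bar R :=
  \esum_(x in [set: I]) (a x)%:E.

Lemma tsum_ge0 (I : choiceType) (a : I -> R) :
  (forall x, 0 <= a x)%R -> 0 <= tsum a.
Proof. by move=> a0; apply: esum_ge0 => x _; rewrite lee_fin. Qed.

Lemma le_tsum (I : choiceType) (a b : I -> R) :
  (forall x, a x <= b x)%R -> tsum a <= tsum b.
Proof. by move=> ab; apply: le_esum => x _; rewrite lee_fin. Qed.

Lemma eq_tsum (I : choiceType) (a b : I -> R) : a =1 b -> tsum a = tsum b.
Proof. by move=> ab; apply: eq_esum => x _; rewrite ab. Qed.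

Lemma tsumD (I : choiceType) (a b : I -> R) :
  (forall x, 0 <= a x)%R -> (forall x, 0 <= b x)%R ->
  tsum (fun x => a x + b x)%R = tsum a + tsum b.
Proof. by move=> a0 b0; rewrite /tsum -esumD// => i _; rewrite lee_fin. Qed.

Lemma esumZ (I : choiceType) (D : set I) (c : R) (a : I -> \bar R) :
  (0 <= c)%R -> (forall x, 0 <= a x) ->
  \esum_(x in D) (c%:E * a x) = c%:E * \esum_(x in D) a x.
Proof.
move=> c0 a0; rewrite /esum.
have [->|c1] := eqVneq c 0%R.
  rewrite mul0e; apply/eqP; rewrite eq_le; apply/andP; split.
    apply: ge_ereal_sup => _ [F _ <-]; rewrite fsbig1// => i _.
    by rewrite mul0e.
  apply: ereal_sup_ubound; exists set0; first exact: fsets_set0.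
  by rewrite fsbig_set0.
have cp : (0 < c)%R by rewrite lt_neqAle eq_sym c1.
apply/eqP; rewrite eq_le; apply/andP; split.
  apply: ge_ereal_sup => _ [F [fF FD] <-].
  rewrite -ge0_mule_fsumr//; apply: lee_pmul => //.
    by apply: fsume_ge0 => //.
  by apply: ereal_sup_ubound; exists F.
rewrite muleC -lee_pdivlMr//; apply: ge_ereal_sup => _ [F [fF FD] <-].
rewrite lee_pdivlMr// muleC ge0_mule_fsumr//.
by apply: ereal_sup_ubound; exists F.
Qed.

Lemma tsumZ (I : choiceType) (c : R) (a : I -> R) :
  (0 <= c)%R -> (forall x, 0 <= a x)%R ->
  tsum (fun x => c * a x)%R = c%:E * tsum a.
Proof. by move=> c0 a0; rewrite /tsum -esumZ// => x; rewrite lee_fin. Qed.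

(** Both iterated sums equal the sum over the product, which the swap of
    coordinates reindexes. *)
Lemma esum_exchange (I J : choiceType) (a : I -> J -> \bar R) :
  (forall i j, 0 <= a i j) ->
  \esum_(i in [set: I]) \esum_(j in [set: J]) a i j =
  \esum_(j in [set: J]) \esum_(i in [set: I]) a i j.
Proof.
move=> a0.
rewrite (@esum_esum _ _ _ _ (fun=> setT))// (@esum_esum _ _ _ _ (fun=> setT))//.
rewrite (reindex_esum ([set: J] `*`` (fun=> [set: I])) _
  (fun x => (x.2, x.1)))//; split=> //=.
  by move=> [i1 i2] [j1 j2] /= _ _ [] -> ->.
by move=> [i1 i2] _ /=; exists (i2, i1).
Qed.

Lemma tsum_term (I : choiceType) (a : I -> R) (x : I) :
  (forall x, 0 <= a x)%R -> (a x)%:E <= tsum a.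
Proof.
move=> a0; apply: esum_ge; exists [set x]; last by rewrite fsbig_set1.
by split.
Qed.

Lemma tsum_fin (I : choiceType) (a : I -> R) :
  (forall x, 0 <= a x)%R -> tsum a < +oo -> tsum a = (fine (tsum a))%:E.
Proof.
move=> a0 h; rewrite fineK// ge0_fin_numE//; exact: tsum_ge0.
Qed.

Lemma tsum_lt (I : choiceType) (a b : I -> R) :
  (forall x, a x <= b x)%R -> tsum b < +oo -> tsum a < +oo.
Proof. by move=> ab; apply: le_lt_trans; exact: le_tsum. Qed.

Lemma fine_tsum_le (I : choiceType) (a b : I -> R) :
  (forall x, 0 <= a x)%R -> (forall x, a x <= b x)%R -> tsum b < +oo ->
  (fine (tsum a) <= fine (tsum b))%R.
Proof.
move=> a0 ab bl; have b0 x : (0 <= b x)%R by apply: le_trans (ab x).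
by rewrite -lee_fin -!tsum_fin ?le_tsum// (tsum_lt ab).
Qed.

Lemma tsum_single (I : choiceType) (x : I) (c : R) : (0 <= c)%R ->
  tsum (fun y => if y == x then c else 0%R) = c%:E.
Proof.
move=> c0; rewrite /tsum -[RHS](@esum_set1 _ _ x (fun=> c%:E))//.
rewrite [RHS]esum_mkcond; apply: eq_esum => y _.
have [->|yx] := eqVneq y x; first by rewrite mem_set.
by rewrite memNset//= => /eqP; rewrite (negbTE yx).
Qed.

Lemma tsum_le_finite (I : choiceType) (a : I -> R) (M : \bar R) :
  (forall s : seq I, uniq s -> (\sum_(x <- s) a x)%:E <= M) -> tsum a <= M.
Proof.
move=> h; apply: ge_ereal_sup => _ [F [fF _] <-].
rewrite fsbig_finite//= sumEFin; exact/h/fset_uniq.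
Qed.

Lemma finite_le_tsum (I : choiceType) (a : I -> R) (s : seq I) :
  (forall x, 0 <= a x)%R -> uniq s -> (\sum_(x <- s) a x)%:E <= tsum a.
Proof.
move=> a0 us; apply: esum_ge; exists [set` s].
  by split => //; exact: finite_seq.
rewrite (fsbig_finite _ _ (finite_seq s))/=.
rewrite sumEFin lee_fin (perm_big (fset_set [set` s]))//=.
apply: uniq_perm => // x; rewrite (in_fset_set (finite_seq s)).
by apply/idP/idP => [h|/set_mem]//; apply/mem_set.
Qed.

Lemma tsum_finite (I : choiceType) (a : I -> R) (s : seq I) :
  (forall x, 0 <= a x)%R -> (forall x, x \notin s -> a x = 0%R) -> uniq s ->
  tsum a = (\sum_(x <- s) a x)%:E.
Proof.
move=> a0 az us; apply/eqP; rewrite eq_le finite_le_tsum// andbT.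
apply: tsum_le_finite => t ut; rewrite lee_fin.
rewrite (bigID (mem s))/= [X in (_ + X)%R]big1 ?addr0; last first.
  by move=> i /az.
rewrite -big_filter [leRHS](bigID (mem t))/=.
rewrite -[X in (_ <= X + _)%R]big_filter.
rewrite (perm_big [seq x <- s | x \in t]).
  by rewrite lerDl; apply: sumr_ge0.
apply: uniq_perm; rewrite ?filter_uniq// => x.
by rewrite !mem_filter andbC.
Qed.

Local Close Scope ereal_scope.

Lemma tsum_norm_lt (I : choiceType) (f g : I -> R) :
  (forall x, `|f x| <= g x) -> (tsum g < +oo)%E ->
  (tsum (fun x => Num.max (f x) 0)%R < +oo)%E /\
  (tsum (fun x => Num.max (- f x) 0)%R < +oo)%E.
Proof.
move=> fg g1; split; apply: tsum_lt g1 => x; rewrite (le_trans _ (fg x))//.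
  by rewrite ge_max ler_norm normr_ge0.
by rewrite ge_max -normrN ler_norm normr_ge0.
Qed.

(** The canonical positive and negative parts can be traded for any other
    summable decomposition [a - b], since [max (a - b) 0 + b] and
    [max (b - a) 0 + a] agree. Linearity and Fubini for [real_sum] all come
    from this freedom. *)
Lemma real_sumB (I : countType) (a b : I -> R) :
  (forall x, 0 <= a x) -> (forall x, 0 <= b x) ->
  (tsum a < +oo)%E -> (tsum b < +oo)%E ->
  real_sum (fun x => a x - b x) = fine (tsum a) - fine (tsum b).
Proof.
move=> a0 b0 al bl.
have pl : (tsum (fun x => Num.max (a x - b x) 0)%R < +oo)%E.
  by apply: tsum_lt al => x; rewrite ge_max a0 andbT gerBl.
have nl : (tsum (fun x => Num.max (- (a x - b x)) 0)%R < +oo)%E.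
  by apply: tsum_lt bl => x; rewrite ge_max b0 andbT opprB gerBl.
have : (tsum (fun x => Num.max (a x - b x) 0 + b x)%R =
        tsum (fun x => Num.max (- (a x - b x)) 0 + a x)%R :> \bar R)%E.
  apply: eq_tsum => x; rewrite opprB.
  by case: (leP (a x - b x) 0); case: (leP (b x - a x) 0) => ? ?; lra.
rewrite !tsumD// => [|x|x]; try by rewrite le_max lexx orbT.
rewrite (tsum_fin _ al)// (tsum_fin _ bl)// (tsum_fin _ pl); last first.
  by move=> x; rewrite le_max lexx orbT.
rewrite (tsum_fin _ nl); last by move=> x; rewrite le_max lexx orbT.
move=> [e]; rewrite /real_sum -/(tsum _) -/(tsum _) /=; lra.
Qed.

Lemma real_sum_posneg (I : countType) (f g : I -> R) :
  (forall x, `|f x| <= g x) -> (tsum g < +oo)%E ->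
  exists a b : I -> R, [/\ f = (fun x => a x - b x),
    (forall x, 0 <= a x) /\ (forall x, 0 <= b x) &
    (tsum a < +oo)%E /\ (tsum b < +oo)%E].
Proof.
move=> fg gl; exists (fun x => Num.max (f x) 0), (fun x => Num.max (- f x) 0).
split; last exact: (tsum_norm_lt fg gl).
  apply/funext => x.
  by case: (leP (f x) 0); case: (leP (- f x) 0) => ? ?; lra.
by split=> x; rewrite le_max lexx orbT.
Qed.

Lemma real_sumD (I : countType) (f g : I -> R) :
  (tsum (fun x => `|f x|)%R < +oo)%E -> (tsum (fun x => `|g x|)%R < +oo)%E ->
  real_sum (fun x => f x + g x) = real_sum f + real_sum g.
Proof.
move=> /(real_sum_posneg (fun=> lexx _))[a [b [-> [a0 b0] [al bl]]]].
move=> /(real_sum_posneg (fun=> lexx _))[c [d [-> [c0 d0] [cl dl]]]].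
rewrite !real_sumB//.
rewrite (_ : (fun x => _) = (fun x => (a x + c x) - (b x + d x))); last first.
  by apply/funext => x; lra.
rewrite real_sumB => [|x|x||]; rewrite ?addr_ge0// !tsumD//.
- rewrite (tsum_fin _ al)// (tsum_fin _ bl)// (tsum_fin _ cl)// (tsum_fin _ dl)//.
  by rewrite /=; lra.
- exact: lte_add_pinfty.
- exact: lte_add_pinfty.
Qed.

Lemma real_sumZ (I : countType) (c : R) (f : I -> R) :
  (tsum (fun x => `|f x|)%R < +oo)%E ->
  real_sum (fun x => c * f x) = c * real_sum f.
Proof.
move=> /(real_sum_posneg (fun=> lexx _))[a [b [-> [a0 b0] [al bl]]]].
rewrite real_sumB//.
have [c0|/ltW c0] := leP 0 c.
  rewrite (_ : (fun x => _) = (fun x => c * a x - c * b x)); last first.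
    by apply/funext => x; lra.
  rewrite real_sumB => [|x|x||]; rewrite ?mulr_ge0// !tsumZ//.
  - rewrite (tsum_fin _ al)// (tsum_fin _ bl)//=; lra.
  - by rewrite (tsum_fin _ al)// -EFinM ltry.
  - by rewrite (tsum_fin _ bl)// -EFinM ltry.
have c1 : 0 <= - c by lra.
rewrite (_ : (fun x => _) = (fun x => (- c) * b x - (- c) * a x)); last first.
  by apply/funext => x; lra.
rewrite real_sumB => [|x|x||]; rewrite ?mulr_ge0// !tsumZ//.
- rewrite (tsum_fin _ al)// (tsum_fin _ bl)//=; lra.
- by rewrite (tsum_fin _ bl)// -EFinM ltry.
- by rewrite (tsum_fin _ al)// -EFinM ltry.
Qed.

Lemma real_sum_le (I : countType) (f g : I -> R) :
  (forall x, `|f x| <= g x) -> (tsum g < +oo)%E ->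
  real_sum f <= fine (tsum g).
Proof.
move=> fg gl; have [pl nl] := tsum_norm_lt fg gl.
rewrite /real_sum -/(tsum _) -/(tsum _).
apply: (@le_trans _ _ (fine (tsum (fun x => Num.max (f x) 0)%R))).
  rewrite gerBl fine_ge0// tsum_ge0// => x.
  by rewrite le_max lexx orbT.
apply: fine_tsum_le => // x; first by rewrite le_max lexx orbT.
by rewrite (le_trans _ (fg x))// ge_max ler_norm/=.
Qed.

(** Fubini, from Tonelli for the positive and the negative part. *)
Lemma real_sum_exchange (I J : countType) (f g : I -> J -> R) :
  (forall i j, `|f i j| <= g i j) ->
  (\esum_(i in [set: I]) tsum (g i) < +oo)%E ->
  real_sum (fun i => real_sum (f i)) =
  real_sum (fun j => real_sum (fun i => f i j)).
Proof.
move=> fg gl.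
pose p i j := Num.max (f i j) 0; pose n i j := Num.max (- f i j) 0.
have p0 i j : 0 <= p i j by rewrite le_max lexx orbT.
have n0 i j : 0 <= n i j by rewrite le_max lexx orbT.
have pg i j : p i j <= g i j.
  by rewrite (le_trans _ (fg i j))// ge_max ler_norm/=.
have ng i j : n i j <= g i j.
  by rewrite (le_trans _ (fg i j))// ge_max -normrN ler_norm/=.
have g0 i j : 0 <= g i j by apply: le_trans (fg i j).
have main (U V : countType) (q : U -> V -> R) : (forall u v, 0 <= q u v) ->
    (\esum_(u in [set: U]) tsum (q u) < +oo)%E ->
    tsum (fun u => fine (tsum (q u))) = \esum_(u in [set: U]) tsum (q u).
  move=> q0 ql; apply: eq_esum => u _; rewrite -tsum_fin//.
  apply: le_lt_trans ql; apply: esum_ge; exists [set u] => //.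
  by rewrite fsbig_set1.
have exch (q : I -> J -> R) : (forall i j, 0 <= q i j) ->
    (\esum_(i in [set: I]) tsum (q i) =
     \esum_(j in [set: J]) tsum (q ^~ j))%E.
  by move=> q0; rewrite /tsum esum_exchange// => i j; rewrite lee_fin.
have pl : (\esum_(i in [set: I]) tsum (p i) < +oo)%E.
  by apply: le_lt_trans gl; apply: le_esum => i _; apply: le_tsum.
have nl : (\esum_(i in [set: I]) tsum (n i) < +oo)%E.
  by apply: le_lt_trans gl; apply: le_esum => i _; apply: le_tsum.
have pl' := pl; have nl' := nl; rewrite exch// in pl'; rewrite exch// in nl'.
rewrite -[LHS]/(real_sum (fun i => fine (tsum (p i)) - fine (tsum (n i)))).
rewrite -[RHS]/(real_sum
  (fun j => fine (tsum (p ^~ j)) - fine (tsum (n ^~ j)))).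
have t0 (U V : countType) (q : U -> V -> R) u : (forall u v, 0 <= q u v) ->
  0 <= fine (tsum (q u)).
  by move=> q0; rewrite fine_ge0// tsum_ge0.
rewrite real_sumB ?main//; try by move=> x; apply: t0.
by rewrite real_sumB ?main ?exch//; move=> x; apply: (t0 _ _ (fun j i => _ i j)).
Qed.

End Sums.

(** * Complex families *)

Section ComplexSums.
Variable R : realType.
Local Notation C := R[i].
Local Notation normc := Normc.normc.

Lemma normc_ge0 (z : C) : 0 <= normc z.
Proof. by case: z => a b; exact: sqrtr_ge0. Qed.

Lemma normc_triangle (z w : C) : normc (z + w) <= normc z + normc w.
Proof. exact: le_normcD. Qed.

Lemma normc_opp (z : C) : normc (- z) = normc z.
Proof. by case: z => a b /=; rewrite !sqrrN. Qed.

Lemma normc_real (a : R) : normc (real_complex R a) = `|a|.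
Proof. by rewrite /= expr0n /= addr0 sqrtr_sqr. Qed.

Lemma Re_le_normc (z : C) : `|complex.Re z| <= normc z.
Proof.
by case: z => a b /=; rewrite -sqrtr_sqr ler_sqrt ?lerDl ?addr_ge0// sqr_ge0.
Qed.

Lemma Im_le_normc (z : C) : `|complex.Im z| <= normc z.
Proof.
by case: z => a b /=; rewrite -sqrtr_sqr ler_sqrt ?lerDr ?addr_ge0// sqr_ge0.
Qed.

Lemma rotate_to_real (z : C) :
  exists2 u : C, normc u = 1 & u * z = real_complex R (normc z).
Proof.
have [->|z0] := eqVneq z 0.
  by exists 1; [exact: Normc.normc1|rewrite mulr0 Normc.normc0].
have n0 : normc z != 0 by apply: contra_neq z0 => /Normc.eq0_normc.
exists (real_complex R (normc z) / z); last by rewrite divfK.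
by rewrite Normc.normcM Normc.normcV normc_real ger0_norm ?normc_ge0// divff.
Qed.

Definition csummable (I : choiceType) (f : I -> C) : Prop :=
  (tsum (fun x => normc (f x)) < +oo)%E.

Section Fixed.
Variable I : countType.
Implicit Types f g : I -> C.

Let abs_lt f (u : I -> R) : csummable f -> (forall x, `|u x| <= normc (f x)) ->
  (tsum (fun x => `|u x|)%R < +oo)%E.
Proof. by move=> fl uf; apply: tsum_lt fl. Qed.

Lemma csummableZ (c : C) f : csummable f -> csummable (fun x => c * f x).
Proof.
move=> fl; rewrite /csummable.
under eq_fun do rewrite Normc.normcM.
rewrite tsumZ ?normc_ge0// => [|x]; last exact: normc_ge0.
by rewrite (tsum_fin _ fl) -?EFinM ?ltry// => x; exact: normc_ge0.
Qed.

Lemma csumD f g : csummable f -> csummable g ->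
  complex_sum (fun x => f x + g x) = complex_sum f + complex_sum g.
Proof.
move=> fl gl; rewrite /complex_sum; apply/eqP; rewrite eq_complex/=.
have E1 : (fun x => complex.Re (f x + g x)) =
          (fun x => complex.Re (f x) + complex.Re (g x)).
  by apply/funext => x; case: (f x); case: (g x).
have E2 : (fun x => complex.Im (f x + g x)) =
          (fun x => complex.Im (f x) + complex.Im (g x)).
  by apply/funext => x; case: (f x); case: (g x).
rewrite E1 E2 !real_sumD ?eqxx//.
- exact: abs_lt fl (fun x => Im_le_normc _).
- exact: abs_lt gl (fun x => Im_le_normc _).
- exact: abs_lt fl (fun x => Re_le_normc _).
- exact: abs_lt gl (fun x => Re_le_normc _).
Qed.

Lemma csumZ (c : C) f : csummable f ->
  complex_sum (fun x => c * f x) = c * complex_sum f.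
Proof.
move=> fl; rewrite /complex_sum; apply/eqP; case: c => a b.
have rl : (tsum (fun x => `|complex.Re (f x)|)%R < +oo)%E.
  exact: abs_lt fl (fun x => Re_le_normc _).
have il : (tsum (fun x => `|complex.Im (f x)|)%R < +oo)%E.
  exact: abs_lt fl (fun x => Im_le_normc _).
have Zl (u : R) (h : I -> R) : (tsum (fun x => `|h x|)%R < +oo)%E ->
    (tsum (fun x => `|u * h x|)%R < +oo)%E.
  move=> hl; under eq_fun do rewrite normrM.
  by rewrite tsumZ// (tsum_fin _ hl)// -EFinM ltry.
have E1 : (fun x => complex.Re (Complex a b * f x)) =
          (fun x => a * complex.Re (f x) + (- b) * complex.Im (f x)).
  by apply/funext => x; case: (f x) => u v /=; rewrite mulNr.
have E2 : (fun x => complex.Im (Complex a b * f x)) =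
          (fun x => a * complex.Im (f x) + b * complex.Re (f x)).
  by apply/funext => x; case: (f x) => u v /=.
rewrite E1 E2 eq_complex !real_sumD ?real_sumZ//; try exact: Zl.
by rewrite /= mulNr !eqxx.
Qed.

(** Rotating the sum onto the positive real axis reduces the triangle
    inequality, with the sharp constant, to a bound for a real sum. *)
Lemma csum_norm_le f : csummable f ->
  ((normc (complex_sum f))%:E <= tsum (fun x => normc (f x)))%E.
Proof.
move=> fl; have [u u1 uz] := rotate_to_real (complex_sum f).
rewrite (tsum_fin _ fl) ?lee_fin => [|x]; last exact: normc_ge0.
have -> : normc (complex_sum f) = complex.Re (complex_sum (fun x => u * f x)).
  by rewrite csumZ// uz.
apply: real_sum_le => [x|//].
by rewrite (le_trans (Re_le_normc _))// Normc.normcM u1 mul1r.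
Qed.

Lemma eq_csum f g : f =1 g -> complex_sum f = complex_sum g.
Proof. by move=> fg; congr complex_sum; apply/funext. Qed.

End Fixed.

Lemma csum_exchange (I J : countType) (f : I -> J -> C) :
  (\esum_(i in [set: I]) tsum (fun j => normc (f i j)) < +oo)%E ->
  complex_sum (fun i => complex_sum (f i)) =
  complex_sum (fun j => complex_sum (fun i => f i j)).
Proof.
move=> fl; rewrite /complex_sum /=; apply/eqP; rewrite eq_complex/=.
apply/andP; split; apply/eqP.
  by apply: (@real_sum_exchange R I J _ (fun i j => normc (f i j))) => // i j;
    exact: Re_le_normc.
by apply: (@real_sum_exchange R I J _ (fun i j => normc (f i j))) => // i j;
  exact: Im_le_normc.
Qed.

Lemma tsum_nat_recl (a : nat -> R) : (forall n, 0 <= a n) ->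
  tsum a = ((a 0%N)%:E + tsum (fun n => a n.+1))%E.
Proof.
move=> a0; rewrite /tsum (esumID [set 0%N])//; last by move=> i; rewrite lee_fin.
rewrite setTI esum_set1 ?lee_fin//; congr (_ + _)%E.
rewrite setTI; apply: reindex_esum; split => //.
- by move=> i j _ _ [].
- by case=> [|n] //= _; exists n.
Qed.

Lemma real_sum_nat_recl (a : nat -> R) : (tsum (fun n => `|a n|)%R < +oo)%E ->
  real_sum a = a 0%N + real_sum (fun n => a n.+1).
Proof.
move=> al; have [pl nl] := tsum_norm_lt (fun=> lexx _) al.
have p0 n : 0 <= Num.max (a n) 0 by rewrite le_max lexx orbT.
have n0 n : 0 <= Num.max (- a n) 0 by rewrite le_max lexx orbT.
have sh (b : nat -> R) : (forall n, 0 <= b n) -> (tsum b < +oo)%E ->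
    fine (tsum b) = b 0%N + fine (tsum (fun n => b n.+1)).
  move=> b0 bl; have bl' : (tsum (fun n => b n.+1) < +oo)%E.
    by apply: le_lt_trans bl; rewrite (tsum_nat_recl b0) leeDr// lee_fin.
  by rewrite (tsum_nat_recl b0) [X in (_ + X)%E](tsum_fin _ bl').
rewrite /real_sum -!/(tsum _) (sh _ p0 pl) (sh _ n0 nl)/=.
set P := fine _; set N := fine _.
by case: (leP (a 0%N) 0); case: (leP (- a 0%N) 0) => ? ?; lra.
Qed.

Lemma csum_nat_recl (a : nat -> C) : csummable a ->
  complex_sum a = a 0%N + complex_sum (fun n => a n.+1).
Proof.
move=> al; rewrite /complex_sum.
rewrite (@real_sum_nat_recl (fun n => complex.Re (a n))); last first.
  by apply: tsum_lt al => n; exact: Re_le_normc.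
rewrite (@real_sum_nat_recl (fun n => complex.Im (a n))); last first.
  by apply: tsum_lt al => n; exact: Im_le_normc.
by case: (a 0%N).
Qed.

(** A form of convergence of the partial sums that loses a factor 2; the limits
    taken below are only needed up to constants. *)
Lemma tsum_nat_half (a : nat -> R) : (forall n, 0 <= a n) ->
  (tsum a < +oo)%E ->
  exists N0, forall N, (N0 <= N)%N -> fine (tsum a) <= 2 * \sum_(i < N) a i.
Proof.
move=> a0 al; have := fine_ge0 (tsum_ge0 a0); rewrite le_eqVlt => /predU1P[<-|].
  by exists 0%N => N _; rewrite mulr_ge0// sumr_ge0.
move=> U0.
have h : (\sum_(0 <= i < n) (a i)%:E)%E @[n --> \oo] --> (fine (tsum a))%:E.
  rewrite -tsum_fin// /tsum -nneseries_esumT => [|n]; last by rewrite lee_fin.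
  by apply: is_cvg_nneseries => n _ _; rewrite lee_fin.
have {h}/cvgrPdist_le /(_ (fine (tsum a) / 2)) :
    (fine \o (fun n => \sum_(0 <= i < n) (a i)%:E)%E) n @[n --> \oo] -->
    fine (tsum a) by exact: fine_cvg h.
rewrite divr_gt0// => /(_ isT) [N0 _ hN]; exists N0 => N NN0.
have := hN N NN0; rewrite /= sumEFin /= big_mkord => /ler_normlP[_]; lra.
Qed.

End ComplexSums.

(** * The co-area inequality *)

Section Coarea.
Variable R : realType.

Lemma ler_sum_subset (I : eqType) (s t : seq I) (a : I -> R) :
  uniq s -> uniq t -> {subset s <= t} -> (forall x, 0 <= a x) ->
  \sum_(x <- s) a x <= \sum_(x <- t) a x.
Proof.
move=> us ut st a0; rewrite [leRHS](bigID (mem s))/=.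
have perm : perm_eq [seq x <- t | x \in s] s.
  apply: uniq_perm; rewrite ?filter_uniq// => x.
  by rewrite mem_filter; have := st x; case: (x \in s) => // /(_ isT) ->.
by rewrite -[X in _ <= X + _]big_filter (perm_big s perm) lerDl sumr_ge0.
Qed.

Lemma double_esum_le (I J : choiceType) (a : I -> J -> R) (M : \bar R) :
  (forall i j, 0 <= a i j) ->
  (forall s t, uniq s -> uniq t ->
    ((\sum_(i <- s) \sum_(j <- t) a i j)%:E <= M)%E) ->
  (\esum_(i in [set: I]) tsum (a i) <= M)%E.
Proof.
move=> a0 h; apply: ge_ereal_sup => _ [F [fF _] <-].
rewrite fsbig_finite//= -esum_sum => [|i j _ _]; last by rewrite lee_fin.
under eq_esum do rewrite sumEFin.
apply: tsum_le_finite => t ut; rewrite exchange_big/=; exact: h.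
Qed.

Lemma seq_argmin (I : eqType) (s : seq I) (H : I -> R) : s != [::] ->
  exists2 x, x \in s & forall y, y \in s -> H x <= H y.
Proof.
elim: s => // z s IH _; have [->|/IH[x xs xm]] := eqVneq s [::].
  by exists z; rewrite ?mem_head// => y; rewrite inE => /eqP->.
have [zx|xz] := leP (H z) (H x).
  exists z; rewrite ?mem_head// => y; rewrite inE => /predU1P[->//|/xm].
  exact: le_trans.
exists x; rewrite ?inE ?xs ?orbT// => y; rewrite inE => /predU1P[->|/xm//].
exact: ltW.
Qed.

(** The layer-cake argument, by removing one level at a time: subtract the
    smallest value [t] of [H]. The layer [t] contributes [t] times the
    isoperimetric hypothesis for the whole list, and the minimiser no longer
    contributes to what is left, so that it can be dropped from the list. *)
Lemma coarea_finite (I : eqType) (D : pred I) (b : I -> I -> R) (m : I -> R)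
    (eta : R) :
  (forall s, uniq s -> all D s ->
    \sum_(x <- s) \sum_(y <- s) b x y <= eta * \sum_(x <- s) m x) ->
  forall (s : seq I) (H : I -> R), uniq s -> all D s ->
    (forall x, x \in s -> 0 <= H x) ->
    \sum_(x <- s) \sum_(y <- s) b x y * Num.min (H x) (H y) <=
    eta * \sum_(x <- s) H x * m x.
Proof.
move=> iso s; move: {2}(size s) (erefl (size s)) => n.
elim: n s => [|n IH] s sn H us Ds H0.
  by rewrite (size0nil sn) !big_nil mulr0.
have [|x0 x0s x0m] := @seq_argmin _ s H; first by rewrite -size_eq0 sn.
pose s' := rem x0 s; pose H' y := H y - H x0.
have us' : uniq s' by exact: rem_uniq.
have Ds' : all D s' by apply/allP => x /mem_rem; exact/allP.
have perm : perm_eq s (x0 :: s') := perm_to_rem x0s.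
have H'0 x : x \in s -> 0 <= H' x by move=> xs; rewrite subr_ge0 x0m.
have IH' : \sum_(x <- s') \sum_(y <- s') b x y * Num.min (H' x) (H' y) <=
    eta * \sum_(x <- s') H' x * m x.
  by apply: IH => //; [rewrite size_rem// sn|move=> x /mem_rem /H'0].
have L : \sum_(x <- s) \sum_(y <- s) b x y * Num.min (H x) (H y) =
    H x0 * (\sum_(x <- s) \sum_(y <- s) b x y) +
    \sum_(x <- s') \sum_(y <- s') b x y * Num.min (H' x) (H' y).
  have -> : \sum_(x <- s') \sum_(y <- s') b x y * Num.min (H' x) (H' y) =
      \sum_(x <- s) \sum_(y <- s) b x y * Num.min (H' x) (H' y).
    have z0 x : x \in s -> Num.min (H' x0) (H' x) = 0.
      by move=> /H'0 h; rewrite {1}/H' subrr; apply/min_idPl.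
    have z1 x : x \in s -> Num.min (H' x) (H' x0) = 0.
      by move=> /H'0 h; rewrite {2}/H' subrr; apply/min_idPr.
    rewrite [RHS](perm_big _ perm)/= big_cons.
    rewrite [X in _ = X + _]big1_seq ?add0r; last first.
      by move=> y /= ys; rewrite z0 ?mulr0.
    apply: eq_big_seq => x /mem_rem xs.
    by rewrite [RHS](perm_big _ perm)/= big_cons z1// mulr0 add0r.
  rewrite mulr_sumr -big_split/=; apply: eq_bigr => x _.
  rewrite mulr_sumr -big_split/=; apply: eq_bigr => y _.
  have -> : Num.min (H x) (H y) = H x0 + Num.min (H' x) (H' y).
    by rewrite addr_minr /H' !subrKC.
  ring.
have Rr : \sum_(x <- s) H x * m x =
    H x0 * (\sum_(x <- s) m x) + \sum_(x <- s') H' x * m x.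
  have -> : \sum_(x <- s') H' x * m x = \sum_(x <- s) H' x * m x.
    by rewrite [RHS](perm_big _ perm)/= big_cons /H' subrr mul0r add0r.
  rewrite mulr_sumr -big_split/=; apply: eq_bigr => x _.
  by rewrite /H'; ring.
rewrite L Rr mulrDr lerD// mulrCA ler_wpM2l//; first exact: H0.
exact: iso.
Qed.

(** For an indicator function [H] this says that the kernel connects a set with
    itself by at most the fraction [eta] of its volume. *)
Definition coarea_bound (X : choiceType) (m : X -> R) (k : X -> X -> R)
    (eta : R) : Prop :=
  forall H : X -> R, (forall x, 0 <= H x) ->
    (\esum_(x in [set: X]) tsum (fun y => k x y * Num.min (H x) (H y))%R <=
     eta%:E * tsum (fun x => H x * m x)%R)%E.

(** The kernel of the compression of an operator to the functions that live
    on [D]. *)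
Definition compress (X : choiceType) (D : pred X) (b : X -> X -> R) (x y : X) : R :=
  if D x && D y then b x y else 0.

(** The inequality for infinitely supported [H] follows from finite lists, as
    both sides are suprema over them. *)
Lemma coarea_compress (X : choiceType) (m : X -> R) (b : X -> X -> R) (D : pred X)
    (eta : R) :
  (forall x y, 0 <= b x y) -> (forall x, 0 <= m x) -> 0 <= eta ->
  (forall s, uniq s -> all D s ->
    \sum_(x <- s) \sum_(y <- s) b x y <= eta * \sum_(x <- s) m x) ->
  coarea_bound m (compress D b) eta.
Proof.
move=> b0 m0 e0 iso H H0.
have min0 x y : 0 <= Num.min (H x) (H y) by rewrite le_min !H0.
have compress0 x y : 0 <= compress D b x y by rewrite /compress; case: ifP.
apply: double_esum_le => [x y|s t us ut]; first by rewrite mulr_ge0.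
pose w := [seq x <- undup (s ++ t) | D x].
have uw : uniq w by rewrite filter_uniq// undup_uniq.
have Dw : all D w by rewrite filter_all.
rewrite -tsumZ => [|//|x]; last by rewrite mulr_ge0.
apply: le_trans (finite_le_tsum _ uw); last by move=> x; rewrite !mulr_ge0.
rewrite lee_fin -mulr_sumr.
apply: le_trans (coarea_finite iso uw Dw (fun x _ => H0 x)).
pose z := undup (s ++ t); have uz : uniq z by exact: undup_uniq.
apply: (@le_trans _ _ (\sum_(x <- z) \sum_(y <- z)
   compress D b x y * Num.min (H x) (H y))).
  apply: (@le_trans _ _ (\sum_(x <- s) \sum_(y <- z)
     compress D b x y * Num.min (H x) (H y))).
    apply: ler_sum => x _; apply: ler_sum_subset => // [y yt|y].
      by rewrite mem_undup mem_cat yt orbT.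
    by rewrite mulr_ge0.
  apply: ler_sum_subset => // [y ys|y].
    by rewrite mem_undup mem_cat ys.
  by apply: sumr_ge0 => ? _; rewrite mulr_ge0.
rewrite /w big_filter [leRHS]big_mkcond/=; apply: ler_sum => x _.
rewrite big_filter [X in if _ then X else _]big_mkcond /compress/=.
case: (D x) => /=; last by rewrite big1// => y _; rewrite mul0r.
by apply: ler_sum => y _; case: (D y); rewrite ?mul0r.
Qed.

End Coarea.

(** * Norms of averaging operators *)

Section Kernel.
Variable R : realType.

(** A crude Young inequality, whose point is that the coefficient of [a `^ p]
    is smaller than 1, so that this term can be absorbed: either [f] is at most
    [a / 2], or [a] is at most [2 f]. *)
Lemma powR_test_half (p f a : R) : 1 < p -> 0 <= f -> 0 <= a ->
  f * a `^ (p - 1) <= 2 `^ (p - 1) * f `^ p + 2^-1 * a `^ p.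
Proof.
move=> p1 f0 a0; have p0 : 0 < p by lra.
have fp := powR_ge0 f p; have ap := powR_ge0 a p.
have [fa|af] := leP (2 * f) a.
  rewrite (@le_trans _ _ (2^-1 * a * a `^ (p - 1)))//.
    by rewrite ler_wpM2r ?powR_ge0//; lra.
  rewrite -mulrA mulr_powRB1// lerDr mulr_ge0// powR_ge0//.
have -> : 2 `^ (p - 1) * f `^ p = f * (2 * f) `^ (p - 1).
  by rewrite powRM// mulrCA mulr_powRB1.
rewrite (@le_trans _ _ (f * (2 * f) `^ (p - 1)))//; last first.
  by rewrite lerDl mulr_ge0.
rewrite ler_wpM2l// ge0_ler_powR ?nnegrE//; lra.
Qed.

(** If one of [f] and [a] is much smaller than the other, then the product is a
    small multiple of the larger power, and otherwise the two powers are
    comparable and the minimum controls it. The first alternative is paid with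
    the small coefficient [s], the second with the co-area inequality. *)
Lemma powR_test_small (p s : R) : 1 < p -> 0 < s ->
  exists2 C, 0 <= C & forall f a, 0 <= f -> 0 <= a ->
    f * a `^ (p - 1) <= C * Num.min (f `^ p) (a `^ p) + s * (f `^ p + a `^ p).
Proof.
move=> p1 s0; have p0 : 0 < p by lra.
(* the threshold at which [a `^ (p - 1) = s * f `^ (p - 1)] *)
pose u := s `^ (p - 1)^-1.
have u0 : 0 < u by exact: powR_gt0.
exists (s^-1 `^ p + u^-1 `^ p); first by rewrite addr_ge0 ?powR_ge0.
move=> f a f0 a0.
have fp := powR_ge0 f p; have ap := powR_ge0 a p.
have sp := powR_ge0 s^-1 p; have up := powR_ge0 u^-1 p.
have q0 : 0 <= p - 1 by lra.
have [fa|af] := leP f a.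
  have -> : Num.min (f `^ p) (a `^ p) = f `^ p.
    by apply/min_idPl; rewrite ge0_ler_powR ?nnegrE// ltW.
  have [fs|sf] := leP f (s * a).
    have : f * a `^ (p - 1) <= s * a `^ p.
      by rewrite -(mulr_powRB1 a0 p0) mulrA ler_wpM2r// powR_ge0.
    by nra.
  have : f * a `^ (p - 1) <= s^-1 `^ p * f `^ p.
    rewrite (@le_trans _ _ (a * a `^ (p - 1)))// ?ler_wpM2r ?powR_ge0//.
    rewrite mulr_powRB1// -powRM ?invr_ge0 ?(ltW s0)//.
    rewrite ge0_ler_powR ?nnegrE ?mulr_ge0 ?invr_ge0 ?(ltW s0) ?(ltW p0)//.
    by rewrite mulrC ler_pdivlMr// mulrC ltW.
  by nra.
have -> : Num.min (f `^ p) (a `^ p) = a `^ p.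
  by apply/min_idPr; rewrite ge0_ler_powR ?nnegrE// ltW.
have [fs|sf] := leP a (u * f).
  have : f * a `^ (p - 1) <= s * f `^ p.
    rewrite -(mulr_powRB1 f0 p0) mulrCA ler_wpM2l//.
    have -> : s = u `^ (p - 1) by rewrite -powRrM mulVf ?powRr1 ?ltW//; lra.
    rewrite -powRM ?(ltW u0)//.
    by rewrite ge0_ler_powR ?nnegrE ?mulr_ge0 ?(ltW u0).
  by nra.
have : f * a `^ (p - 1) <= u^-1 `^ p * a `^ p.
  rewrite (@le_trans _ _ (f * f `^ (p - 1)))//.
    by rewrite ler_wpM2l// ge0_ler_powR ?nnegrE// ltW.
  rewrite mulr_powRB1// -powRM ?invr_ge0 ?(ltW u0)//.
  rewrite ge0_ler_powR ?nnegrE ?mulr_ge0 ?invr_ge0 ?(ltW u0) ?(ltW p0)//.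
  by rewrite mulrC ler_pdivlMr// mulrC ltW.
by nra.
Qed.

Variables (X : countType) (m : X -> R).
Hypothesis m_gt0 : forall x, 0 < m x.

(** The p-th power of the weighted norm of a nonnegative function; [lp_mass] is
    the mass of the absolute value. *)
Definition mass (p : R) (f : X -> R) : \bar R :=
  tsum (fun x => f x `^ p * m x).

Lemma mass_ge0 p f : (0 <= mass p f)%E.
Proof. by apply: tsum_ge0 => x; rewrite mulr_ge0 ?powR_ge0// ltW. Qed.

Lemma mass_fin p f : (mass p f < +oo)%E -> mass p f = (fine (mass p f))%:E.
Proof. by move=> h; apply: tsum_fin => // x; rewrite mulr_ge0 ?powR_ge0// ltW. Qed.

Lemma le_mass p f g : 0 <= p -> (forall x, 0 <= f x) ->
  (forall x, f x <= g x) -> (mass p f <= mass p g)%E.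
Proof.
move=> p0 f0 fg; apply: le_tsum => x; apply: ler_wpM2r; first exact: ltW.
by rewrite ge0_ler_powR ?nnegrE// (le_trans (f0 x)).
Qed.

Lemma powRD_le (p a b : R) : 0 <= p -> 0 <= a -> 0 <= b ->
  (a + b) `^ p <= 2 `^ p * (a `^ p + b `^ p).
Proof.
move=> p0 a0 b0; have ap := powR_ge0 a p; have bp := powR_ge0 b p.
have t0 := powR_ge0 (2 : R) p.
have [ab|ba] := leP a b.
  apply: (@le_trans _ _ ((2 * b) `^ p)).
    by rewrite ge0_ler_powR ?nnegrE//; lra.
  by rewrite powRM// ler_wpM2l// lerDr.
apply: (@le_trans _ _ ((2 * a) `^ p)).
  by rewrite ge0_ler_powR ?nnegrE//; lra.
by rewrite powRM// ler_wpM2l// lerDl.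
Qed.

Lemma massD p f g : 0 <= p -> (forall x, 0 <= f x) -> (forall x, 0 <= g x) ->
  (mass p (fun x => f x + g x)%R <=
   (2 `^ p)%:E * (mass p f + mass p g))%E.
Proof.
move=> p0 f0 g0; rewrite /mass -tsumD; last 2 first.
  by move=> x; rewrite mulr_ge0 ?powR_ge0// ltW.
  by move=> x; rewrite mulr_ge0 ?powR_ge0// ltW.
rewrite -tsumZ ?powR_ge0//; last first.
  by move=> x; rewrite addr_ge0// mulr_ge0 ?powR_ge0// ltW.
apply: le_tsum => x; rewrite -mulrDl [leRHS]mulrA.
apply: ler_wpM2r; [exact: ltW|exact: powRD_le].
Qed.

Lemma massZ p c f : 0 <= c -> (forall x, 0 <= f x) ->
  (mass p (fun x => c * f x)%R = (c `^ p)%:E * mass p f)%E.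
Proof.
move=> c0 f0; rewrite /mass -tsumZ ?powR_ge0//; last first.
  by move=> x; rewrite mulr_ge0 ?powR_ge0// ltW.
by apply: eq_tsum => x; rewrite powRM// mulrA.
Qed.

Lemma mass_ge_term p f x : ((f x `^ p * m x)%:E <= mass p f)%E.
Proof.
by apply: tsum_term => y; rewrite mulr_ge0 ?powR_ge0// ltW.
Qed.

(** The averaging operator of the kernel, on nonnegative functions. When the kernel
    is the edge weight, [m] the degree and there is no killing, this is [1 - L]. *)
Definition avg (k : X -> X -> R) (f : X -> R) (x : X) : R :=
  (m x)^-1 * fine (tsum (fun y => k x y * f y)).

Record sub_markov (k : X -> X -> R) : Prop := SubMarkov {
  sub_markov_ge0 : forall x y, 0 <= k x y;
  sub_markov_row : forall x, (tsum (k x) <= (m x)%:E)%E;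
  sub_markov_col : forall y, (tsum (k ^~ y) <= (m y)%:E)%E }.

Section Fixed.
Variable k : X -> X -> R.
Hypothesis kk : sub_markov k.
Let k0 := sub_markov_ge0 kk.

Lemma kernel_row_sum (g : X -> R) : (forall x, 0 <= g x) ->
  (\esum_(x in [set: X]) tsum (fun y => k x y * g x)%R <=
   tsum (fun x => g x * m x)%R)%E.
Proof.
move=> g0; apply: le_esum => x _.
under eq_tsum do rewrite mulrC.
rewrite tsumZ// EFinM; apply: lee_pmul => //; rewrite ?lee_fin//.
  exact: tsum_ge0.
exact: sub_markov_row.
Qed.

Lemma kernel_col_sum (g : X -> R) : (forall x, 0 <= g x) ->
  (\esum_(x in [set: X]) tsum (fun y => k x y * g y)%R <=
   tsum (fun x => g x * m x)%R)%E.
Proof.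
move=> g0; rewrite /tsum esum_exchange => [|i j]; last by rewrite lee_fin mulr_ge0.
apply: le_esum => y _; rewrite -/(tsum _).
under eq_tsum do rewrite mulrC.
rewrite tsumZ// EFinM; apply: lee_pmul => //; rewrite ?lee_fin//.
  exact: tsum_ge0.
exact: sub_markov_col.
Qed.

Lemma kernel_sum_lt p f x : 1 < p -> (forall y, 0 <= f y) ->
  (mass p f < +oo)%E -> (tsum (fun y => k x y * f y)%R < +oo)%E.
Proof.
move=> p1 f0 fl.
apply: (@le_lt_trans _ _ (tsum (fun y => k x y + k x y * f y `^ p)%R)).
  apply: le_tsum => y; rewrite -{2}(mulr1 (k x y)) -mulrDr ler_wpM2l//.
  have [f1|f1] := leP (f y) 1; first by rewrite (le_trans f1)// lerDl powR_ge0.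
  rewrite (@le_trans _ _ (f y `^ p))// ?lerDr//.
  by rewrite le1r_powR// ltW.
rewrite tsumD// => [|y]; last by rewrite mulr_ge0// powR_ge0.
apply: lte_add_pinfty.
  by apply: le_lt_trans (sub_markov_row kk x) _; rewrite ltry.
apply: le_lt_trans fl; apply: le_trans (kernel_col_sum (fun y => powR_ge0 _ _)).
apply: esum_ge; exists [set x] => //.
by rewrite fsbig_set1.
Qed.

Lemma avg_ge0 f x : (forall y, 0 <= f y) -> 0 <= avg k f x.
Proof.
move=> f0; rewrite mulr_ge0 ?invr_ge0 ?(ltW (m_gt0 x))//.
by rewrite fine_ge0// tsum_ge0// => y; rewrite mulr_ge0.
Qed.

(** Duality against the optimal test function: with [a] the average of [f] cut
    off to a finite set, pairing the average with [a `^ (p - 1)] gives back the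
    mass of [a], and half of it is absorbed. The cut-off makes the absorbed
    quantity finite, and letting the finite set grow gives the claim. *)
Lemma mass_avg_test (p sigma : R) (f : X -> R) : 1 < p -> 0 <= sigma ->
  (forall y, 0 <= f y) -> (mass p f < +oo)%E ->
  (forall a, (forall x, 0 <= a x) ->
    (\esum_(x in [set: X]) tsum (fun y => k x y * (f y * a x `^ (p - 1)))%R <=
     sigma%:E * mass p f + 2^-1%:E * mass p a)%E) ->
  (mass p (avg k f) <= (2 * sigma)%:E * mass p f)%E.
Proof.
move=> p1 s0 f0 fl test; have p0 : 0 < p by lra.
apply: tsum_le_finite => s us.
pose a x := if x \in s then avg k f x else 0.
have a0 x : 0 <= a x by rewrite /a; case: ifP => // _; exact: avg_ge0.
have Ms : mass p a = (\sum_(x <- s) a x `^ p * m x)%:E.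
  apply: tsum_finite => // x; first by rewrite mulr_ge0 ?powR_ge0// ltW.
  by rewrite /a => /negbTE ->; rewrite powR0 ?mul0r// gt_eqF.
have -> : \sum_(x <- s) avg k f x `^ p * m x = \sum_(x <- s) a x `^ p * m x.
  by apply: eq_big_seq => x xs; rewrite /a xs.
set A := \sum_(x <- s) _ in Ms *.
have : (A%:E <= sigma%:E * mass p f + 2^-1%:E * A%:E)%E.
  rewrite -{2}Ms; apply: le_trans (test a a0).
  pose F x := fine (tsum (fun y => k x y * (f y * a x `^ (p - 1)))%R).
  have F0 x : (0 <= tsum (fun y => k x y * (f y * a x `^ (p - 1)))%R)%E.
    by apply: tsum_ge0 => y; rewrite !mulr_ge0// powR_ge0.
  have FE x : tsum (fun y => k x y * (f y * a x `^ (p - 1)))%R =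
      (a x `^ (p - 1) * fine (tsum (fun y => k x y * f y)))%:E.
    under eq_tsum do rewrite mulrA mulrC.
    rewrite tsumZ ?powR_ge0// => [|y]; last by rewrite mulr_ge0.
    rewrite (tsum_fin _ (kernel_sum_lt x p1 f0 fl))//.
    by move=> y; rewrite mulr_ge0.
  rewrite /tsum (_ : A%:E = \esum_(x in [set` s]) (F x)%:E)%E; last first.
    rewrite esum_fset ?finite_seq// => [|i _]; last by rewrite lee_fin fine_ge0.
    rewrite -fsbig_seq//= sumEFin; congr _%:E.
    apply: eq_big_seq => x xs; rewrite /F FE/= -(mulr_powRB1 (a0 x) p0) {1}/a xs.
    rewrite /avg; field; exact: lt0r_neq0.
  rewrite esum_mkcond; apply: le_esum => x _; case: ifP => _; last exact: F0.
  by rewrite /F -/(tsum _) FE.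
have fM : (0 <= fine (mass p f)) by rewrite fine_ge0// mass_ge0.
rewrite (mass_fin fl) -!EFinM -EFinD !lee_fin; lra.
Qed.

Lemma mass_avg_le p f : 1 < p -> (forall y, 0 <= f y) ->
  (mass p f < +oo)%E -> (mass p (avg k f) <= (2 `^ p)%:E * mass p f)%E.
Proof.
move=> p1 f0 fl; rewrite -(@mulr_powRB1 _ 2 p)//; last by lra.
apply: mass_avg_test; rewrite ?powR_ge0// => a a0.
pose g y := 2 `^ (p - 1) * f y `^ p; pose h x := 2^-1 * a x `^ p.
have g0 y : 0 <= g y by rewrite mulr_ge0 ?powR_ge0.
have h0 y : 0 <= h y by rewrite mulr_ge0 ?powR_ge0.
apply: (@le_trans _ _ (\esum_(x in [set: X])
  (tsum (fun y => k x y * g y)%R + tsum (fun y => k x y * h x)%R))%E).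
  apply: le_esum => x _; rewrite -tsumD => [|y|y]; try by rewrite mulr_ge0.
  by apply: le_tsum => y; rewrite -mulrDr ler_wpM2l// powR_test_half.
rewrite esumD => [|x _|x _]; try by apply: tsum_ge0 => y; rewrite mulr_ge0.
apply: leeD.
  apply: le_trans (kernel_col_sum g0) _.
  rewrite /mass -tsumZ ?powR_ge0// => [|x]; last first.
    by rewrite mulr_ge0 ?powR_ge0// ltW.
  by apply: le_tsum => x; rewrite mulrA.
apply: le_trans (kernel_row_sum h0) _.
rewrite /mass -tsumZ// => [|x]; last by rewrite mulr_ge0 ?powR_ge0// ltW.
by apply: le_tsum => x; rewrite mulrA.
Qed.

End Fixed.

(** The co-area inequality makes averaging small on every [l^p] with [1 < p] at
    once, without interpolation: [powR_test_small] is summed against the kernel,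
    with the co-area inequality applied to [H = f `^ p + a `^ p], whose minimum
    at two vertices dominates that of [f `^ p] at one and [a `^ p] at the
    other. *)
Lemma mass_avg_small p delta : 1 < p -> 0 < delta ->
  exists2 eta, 0 < eta & forall k, sub_markov k -> coarea_bound m k eta ->
  forall f, (forall y, 0 <= f y) -> (mass p f < +oo)%E ->
    (mass p (avg k f) <= delta%:E * mass p f)%E.
Proof.
move=> p1 d0.
pose sigma := Num.min (delta / 2) 2^-1.
have s0 : 0 < sigma by rewrite /sigma lt_min; apply/andP; split; lra.
have [C C0 test] := powR_test_small p1 (divr_gt0 s0 (ltr0n R 2)).
exists (sigma / 2 / (C + 1)); first by rewrite !divr_gt0//; lra.
move=> k kk co f f0 fl; have k0 := sub_markov_ge0 kk.
apply: (@le_trans _ _ ((2 * sigma)%:E * mass p f)%E); last first.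
  apply: lee_pmul => //; rewrite ?lee_fin ?mass_ge0//; first lra.
  have : sigma <= delta / 2 by rewrite /sigma ge_min lexx.
  lra.
apply: mass_avg_test => //; first exact: ltW.
move=> a a0.
pose H x := f x `^ p + a x `^ p.
pose g x := sigma / 2 * f x `^ p; pose h x := sigma / 2 * a x `^ p.
have s2 : 0 <= sigma / 2 by lra.
have H0 x : 0 <= H x by rewrite addr_ge0 ?powR_ge0.
have g0 y : 0 <= g y by rewrite mulr_ge0 ?powR_ge0.
have h0 y : 0 <= h y by rewrite mulr_ge0 ?powR_ge0.
have min0 x y : 0 <= Num.min (H x) (H y) by rewrite le_min !H0.
pose T1 x := tsum (fun y => C * (k x y * Num.min (H x) (H y))).
pose T2 x := tsum (fun y => k x y * g y); pose T3 x := tsum (fun y => k x y * h x).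
have T20 x : (0 <= T2 x)%E by apply: tsum_ge0 => y; rewrite mulr_ge0.
have T30 x : (0 <= T3 x)%E by apply: tsum_ge0 => y; rewrite mulr_ge0.
apply: (@le_trans _ _ (\esum_(x in [set: X]) (T1 x + (T2 x + T3 x)))%E).
  apply: le_esum => x _.
  have k3 u y : 0 <= u y -> 0 <= k x y * u y by move=> ?; rewrite mulr_ge0.
  have T1y y : 0 <= C * (k x y * Num.min (H x) (H y)).
    by rewrite !mulr_ge0.
  rewrite /T1 /T2 /T3 -(tsumD (fun y => k3 g y (g0 y)) (fun y => k3 _ y (h0 x))).
  rewrite -(tsumD T1y) => [|y]; last by rewrite addr_ge0// mulr_ge0.
  apply: le_tsum => y.
  rewrite -mulrDr [X in _ <= X + _]mulrCA -mulrDr ler_wpM2l//.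
  rewrite (le_trans (test _ _ (f0 y) (a0 x)))// /g /h -mulrDr lerD2r ler_wpM2l//.
  rewrite le_min !ge_min /H.
  by apply/andP; split; apply/orP; [right|left]; rewrite ?lerDl ?lerDr powR_ge0.
rewrite esumD => [|x _|x _]; rewrite ?adde_ge0//; last first.
  by apply: tsum_ge0 => y; rewrite !mulr_ge0.
rewrite esumD//.
rewrite (@eq_esum _ _ _ T1
  (fun x => C%:E * tsum (fun y => k x y * Num.min (H x) (H y))%R)%E); last first.
  by move=> x _; rewrite /T1 tsumZ// => y; rewrite mulr_ge0.
rewrite esumZ// => [|x]; last by apply: tsum_ge0 => y; rewrite mulr_ge0.
have MM : tsum (fun x => H x * m x)%R = (mass p f + mass p a)%E.
  rewrite /mass -tsumD => [|x|x]; try by rewrite mulr_ge0 ?powR_ge0// ltW.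
  by apply: eq_tsum => x; rewrite mulrDl.
have gM : (\esum_(x in [set: X]) tsum (fun y => k x y * g y)%R <=
    (sigma / 2)%:E * mass p f)%E.
  apply: le_trans (kernel_col_sum kk g0) _.
  rewrite /mass -tsumZ// => [|x]; last by rewrite mulr_ge0 ?powR_ge0// ltW.
  by apply: le_tsum => x; rewrite mulrA.
have hM : (\esum_(x in [set: X]) tsum (fun y => k x y * h x)%R <=
    (sigma / 2)%:E * mass p a)%E.
  apply: le_trans (kernel_row_sum kk h0) _.
  rewrite /mass -tsumZ// => [|x]; last by rewrite mulr_ge0 ?powR_ge0// ltW.
  by apply: le_tsum => x; rewrite mulrA.
have cM : (C%:E * (\esum_(x in [set: X])
      tsum (fun y => k x y * Num.min (H x) (H y))%R) <=
    (sigma / 2)%:E * (mass p f + mass p a))%E.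
  apply: (@le_trans _ _ (C%:E * ((sigma / 2 / (C + 1))%:E *
      (mass p f + mass p a)))%E).
    by rewrite lee_wpmul2l ?lee_fin// -MM co.
  rewrite muleA -EFinM lee_wpmul2r ?adde_ge0 ?mass_ge0// lee_fin.
  by rewrite mulrA ler_pdivrMr; nra.
apply: le_trans (leeD cM (leeD gM hM)) _.
have Ma := mass_ge0 p a; have Mf := mass_ge0 p f.
rewrite -ge0_muleDr// -ge0_muleDl ?lee_fin// -EFinD -splitr ge0_muleDr//.
rewrite leeD2l// lee_wpmul2r// lee_fin /sigma ge_min lexx orbT//.
Qed.

End Kernel.

(** * A priori estimates for contracting kernels *)

Section Neumann.
Variable R : realType.
Local Notation C := R[i].
Local Notation normc := Normc.normc.
Variables (X : countType) (m : X -> R).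
Hypothesis m_gt0 : forall x, 0 < m x.

(** A lemma of Fatou type. *)
Lemma mass_limit p (u : nat -> X -> R) (U : X -> R) (M : \bar R) :
  0 < p -> (forall n x, 0 <= u n x) -> (forall x, 0 <= U x) ->
  (forall x, exists N0, forall N, (N0 <= N)%N -> U x <= 2 * u N x) ->
  (forall n, (mass m p (u n) <= M)%E) ->
  (mass m p U <= (2 `^ p)%:E * M)%E.
Proof.
move=> p0 u0 U0 lim uM; apply: tsum_le_finite => s us.
have [N hN] : exists N, forall x, x \in s -> U x <= 2 * u N x.
  suff [N hN] : exists N0, forall N, (N0 <= N)%N ->
      forall x, x \in s -> U x <= 2 * u N x by exists N; exact: hN.
  elim: (s) => [|x t [N1 h1]]; first by exists 0%N.
  have [N2 h2] := lim x; exists (maxn N1 N2) => N.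
  rewrite geq_max => /andP[N1N N2N] y; rewrite inE => /predU1P[->|]; first exact: h2.
  exact: h1.
apply: (@le_trans _ _ ((2 `^ p)%:E * mass m p (u N))%E); last first.
  by rewrite lee_wpmul2l// lee_fin powR_ge0.
rewrite -massZ//; apply: le_trans (finite_le_tsum _ us); last first.
  by move=> x; rewrite mulr_ge0 ?powR_ge0// ltW.
rewrite lee_fin big_seq [leRHS]big_seq; apply: ler_sum => x xs; apply: ler_wpM2r; first exact: ltW.
by apply: ge0_ler_powR; rewrite ?nnegrE ?mulr_ge0 ?hN// ltW.
Qed.

Lemma mass0 p : 0 < p -> mass m p (fun=> 0) = 0%E.
Proof.
move=> p0; rewrite /mass (tsum_finite (s := [::]))// ?big_nil// => x;
by rewrite powR0 ?mul0r ?gt_eqF.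
Qed.

Section Fixed.
Variables (k : X -> X -> R) (c : R).
Hypotheses (kk : sub_markov m k) (c0 : 0 <= c).
Let k0 := sub_markov_ge0 kk.

Let B f x := c * avg m k f x.

Lemma le_avg p f g x : 1 < p -> (forall y, 0 <= f y) ->
  (forall y, f y <= g y) -> (mass m p g < +oo)%E -> avg m k f x <= avg m k g x.
Proof.
move=> p1 f0 fg gl; rewrite ler_wpM2l ?invr_ge0 ?(ltW (m_gt0 x))//.
have g0 y : 0 <= g y by apply: le_trans (fg y).
have fl : (mass m p f < +oo)%E.
  by apply: le_lt_trans gl; apply: le_mass => //; lra.
apply: fine_tsum_le => [y|y|]; [by rewrite mulr_ge0|by rewrite ler_wpM2l|].
exact: (kernel_sum_lt kk x p1 g0 gl).
Qed.

Lemma avgD p r f g x : 1 < p -> 1 < r ->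
  (forall y, 0 <= f y) -> (forall y, 0 <= g y) ->
  (mass m p f < +oo)%E -> (mass m r g < +oo)%E ->
  avg m k (fun y => f y + g y) x = avg m k f x + avg m k g x.
Proof.
move=> p1 r1 f0 g0 fl gl; rewrite /avg -mulrDr.
have F := kernel_sum_lt kk x p1 f0 fl.
have G := kernel_sum_lt kk x r1 g0 gl.
under eq_tsum do rewrite mulrDr.
rewrite tsumD => [|y|y]; rewrite ?mulr_ge0// fineD// ge0_fin_numE ?tsum_ge0//;
  by move=> y; rewrite mulr_ge0.
Qed.

(** The factor 1/2 makes iterates decay, and the factor [2 `^ p] compensates the
    loss in [massD], so that the partial Neumann sums stay bounded. *)
Definition contracting p : Prop :=
  forall f, (forall y, 0 <= f y) -> (mass m p f < +oo)%E ->
    (mass m p (B f) <= ((2 `^ p)^-1 * 2^-1)%:E * mass m p f)%E.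

Lemma contracting_lt p f : contracting p -> (forall y, 0 <= f y) ->
  (mass m p f < +oo)%E -> (mass m p (B f) < +oo)%E.
Proof.
move=> ct f0 fl; apply: le_lt_trans (ct f f0 fl) _.
by rewrite (mass_fin m_gt0 fl) -EFinM ltry.
Qed.

Lemma B_ge0 f x : (forall y, 0 <= f y) -> 0 <= B f x.
Proof. by move=> f0; rewrite mulr_ge0// avg_ge0. Qed.

(** The partial Neumann sums of the series for [(1 - B)^-1 h]. *)
Fixpoint partial (h : X -> R) (n : nat) : X -> R :=
  if n is n'.+1 then fun x => h x + B (partial h n') x else fun=> 0.

Section Iterate.
Variables (p : R) (h : X -> R).
Hypotheses (p1 : 1 < p) (ct : contracting p).
Hypotheses (h0 : forall x, 0 <= h x) (hl : (mass m p h < +oo)%E).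

Lemma partial_ge0 n x : 0 <= partial h n x.
Proof. by elim: n x => //= n IH x; rewrite addr_ge0// B_ge0. Qed.

Lemma partial_bound n :
  (mass m p (partial h n) <= (2 * 2 `^ p)%:E * mass m p h)%E.
Proof.
have p0 : 0 < p by exact: lt_trans p1.
have t0 : 0 < 2 `^ p :> R by exact: powR_gt0.
have hM := mass_fin m_gt0 hl; have hM0 := mass_ge0 m_gt0 p h.
elim: n => [|n IH]; first by rewrite /= mass0// mule_ge0// lee_fin; lra.
have ul : (mass m p (partial h n) < +oo)%E.
  by apply: le_lt_trans IH _; rewrite hM -EFinM ltry.
apply: le_trans (massD m_gt0 (ltW p0) h0 _) _.
  by move=> x; rewrite B_ge0//; exact: partial_ge0.
have := ct (partial_ge0 n) ul.
move=> /le_trans /(_ (lee_wpmul2l _ IH)) => /(_ _)/wrap[].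
  by rewrite lee_fin mulr_ge0// invr_ge0 ltW.
move=> bn; apply: le_trans (lee_wpmul2l _ (leeD2l _ bn)) _.
  by rewrite lee_fin ltW.
rewrite hM -!EFinM -?EFinD -?EFinM lee_fin le_eqVlt; apply/orP; left; apply/eqP=> /=.
by field; rewrite gt_eqF.
Qed.

Lemma partial_lt n : (mass m p (partial h n) < +oo)%E.
Proof.
apply: le_lt_trans (partial_bound n) _.
by rewrite (mass_fin m_gt0 hl) -EFinM ltry.
Qed.

End Iterate.

Lemma iter_small p v x e : 1 < p -> contracting p -> (forall x, 0 <= v x) ->
  (mass m p v < +oo)%E -> 0 < e ->
  exists N0, forall N, (N0 <= N)%N -> iter N B v x <= e.
Proof.
move=> p1 ct v0 vl e0; have p0 : 0 < p by lra.
have w0 n y : 0 <= iter n B v y.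
  by elim: n y => //= n IH y; exact: B_ge0.
have t1 : 1 <= 2 `^ p :> R.
  by apply: le_trans (le1r_powR (ler1n R 2) (ltW p1)); rewrite ler1n.
have wb n : (mass m p (iter n B v) <= ((2 ^+ n)^-1)%:E * mass m p v)%E.
  elim: n => [|n IH]; first by rewrite expr0 invr1 mul1e.
  have wl : (mass m p (iter n B v) < +oo)%E.
    by apply: le_lt_trans IH _; rewrite (mass_fin m_gt0 vl) -EFinM ltry.
  apply: le_trans (ct _ (w0 n) wl) _.
  apply: le_trans (lee_wpmul2l _ IH) _.
    by rewrite lee_fin mulr_ge0// invr_ge0 powR_ge0.
  rewrite muleA -EFinM lee_wpmul2r ?mass_ge0// lee_fin exprS invfM.
  rewrite ler_wpM2r ?invr_ge0 ?exprn_ge0// ler_piMl ?invr_ge0//.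
  by rewrite invf_le1// powR_gt0.
pose M := fine (mass m p v).
have M0 : 0 <= M by rewrite fine_ge0// mass_ge0.
have em : 0 < e `^ p * m x by rewrite mulr_gt0// powR_gt0.
have [N0 hN0] : exists N0 : nat, M / (e `^ p * m x) < N0%:R.
  by exists (Num.bound (M / (e `^ p * m x))); apply: archi_boundP; rewrite divr_ge0// ltW.
exists N0 => N NN; rewrite leNgt; apply/negP => ew.
have := le_trans (mass_ge_term m_gt0 p (iter N B v) x) (wb N).
rewrite (mass_fin m_gt0 vl) -EFinM lee_fin leNgt => /negP; apply.
rewrite ltr_pdivrMl ?exprn_gt0// -/M.
have tN : N0%:R <= 2 ^+ N :> R.
  rewrite (@le_trans _ _ N%:R) ?ler_nat// -natrX ler_nat ltnW//.
  exact: ltn_expl.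
apply: (@lt_le_trans _ _ (2 ^+ N * (e `^ p * m x))).
  move: hN0; rewrite ltr_pdivrMr// => hN0; apply: lt_le_trans hN0 _.
  by rewrite ler_wpM2r// ltW.
rewrite ler_wpM2l ?exprn_ge0// ler_wpM2r ?(ltW (m_gt0 x))//.
by rewrite ge0_ler_powR ?nnegrE// ltW.
Qed.

(** A subsolution [v <= h + B v] in [l^p] with [h] in [l^r] lies in [l^r]: iterating
    the inequality bounds [v] by a partial Neumann sum, bounded in [l^r], plus an
    iterate of [B] on [v], which tends to 0 in [l^p] and therefore pointwise. *)
Lemma mass_regularity p r v h : 1 < p -> 1 < r ->
  contracting p -> contracting r ->
  (forall x, 0 <= v x) -> (forall x, 0 <= h x) ->
  (mass m p v < +oo)%E -> (mass m r h < +oo)%E ->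
  (forall x, v x <= h x + B v x) ->
  (mass m r v <= (2 `^ r * (2 * 2 `^ r))%:E * mass m r h)%E.
Proof.
move=> p1 r1 ctp ctr v0 h0 vl hl vB.
have w0 n y : 0 <= iter n B v y.
  by elim: n y => //= n IH y; exact: B_ge0.
have wl n : (mass m p (iter n B v) < +oo)%E.
  by elim: n => //= n IH; exact: contracting_lt.
have u0 := partial_ge0 h0; have ul := partial_lt r1 ctr h0 hl.
have vuw n x : v x <= partial h n x + iter n B v x.
  elim: n x => [|n IH] x; first by rewrite add0r.
  apply: le_trans (vB x) _; rewrite /= -addrA lerD2l -mulrDr ler_wpM2l//.
  rewrite -(avgD x r1 p1 (u0 n) (w0 n) (ul n) (wl n)).
  rewrite ler_wpM2l ?invr_ge0 ?(ltW (m_gt0 x))//.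
  have S2 := kernel_sum_lt kk x r1 (u0 n) (ul n).
  have S3 := kernel_sum_lt kk x p1 (w0 n) (wl n).
  apply: fine_tsum_le => [y|y|]; [by rewrite mulr_ge0|by rewrite ler_wpM2l|].
  under eq_tsum do rewrite mulrDr.
  rewrite tsumD; try by move=> y; rewrite mulr_ge0.
  exact: lte_add_pinfty.
rewrite EFinM -muleA.
(* the positive part of [v - B^n v] is below the partial sums and tends to [v] *)
apply: (@mass_limit _ (fun n x => Num.max (v x - iter n B v x) 0)) => //.
- lra.
- by move=> n x; rewrite le_max lexx orbT.
- move=> x; have := v0 x; rewrite le_eqVlt => /predU1P[<-|vx].
    by exists 0%N => N _; rewrite mulr_ge0// le_max lexx orbT.
  have [N0 hN] := iter_small x p1 ctp v0 vl (divr_gt0 vx (ltr0n R 2)).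
  exists N0 => N /hN iN.
  have : v x - iter N B v x <= Num.max (v x - iter N B v x) 0.
    by rewrite le_max lexx.
  lra.
- move=> n; apply: le_trans (partial_bound r1 ctr h0 hl n).
  apply: le_mass => //; first lra.
    by move=> x; rewrite le_max lexx orbT.
  by move=> x; rewrite ge_max u0 andbT lerBlDr.
Qed.

End Fixed.
End Neumann.

(** * The Neumann series *)

Section ComplexAverage.
Variable R : realType.
Local Notation C := R[i].
Local Notation normc := Normc.normc.
Variables (X : countType) (m : X -> R).
Hypothesis m_gt0 : forall x, 0 < m x.

Definition cavg (k : X -> X -> R) (f : X -> C) (x : X) : C :=
  real_complex R (m x)^-1 *
    complex_sum (fun y => real_complex R (k x y) * f y).

Section Fixed.
Variables (k : X -> X -> R).
Hypotheses (kk : sub_markov m k).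
Let k0 := sub_markov_ge0 kk.

Lemma normc_kernel (f : X -> C) x y :
  normc (real_complex R (k x y) * f y) = k x y * normc (f y).
Proof. by rewrite Normc.normcM normc_real ger0_norm. Qed.

Lemma kernel_csummable p f x : 1 < p -> lp m p f ->
  csummable (fun y => real_complex R (k x y) * f y).
Proof.
move=> p1 fl; rewrite /csummable; under eq_fun do rewrite normc_kernel.
exact: (kernel_sum_lt kk x p1 (fun y => normc_ge0 _) fl).
Qed.

Lemma normc_cavg p f x : 1 < p -> lp m p f ->
  normc (cavg k f x) <= avg m k (fun y => normc (f y)) x.
Proof.
move=> p1 fl; rewrite Normc.normcM normc_real ger0_norm ?invr_ge0 ?(ltW (m_gt0 x))//.
rewrite ler_wpM2l ?invr_ge0 ?(ltW (m_gt0 x))//.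
have S := kernel_csummable x p1 fl.
have := csum_norm_le S; rewrite (tsum_fin _ S) => [|y]; last exact: normc_ge0.
rewrite lee_fin => /le_trans; apply; rewrite le_eqVlt; apply/orP; left; apply/eqP.
by congr fine; apply: eq_tsum => y; rewrite normc_kernel.
Qed.

Lemma cavg_linear p a f g : 1 < p -> lp m p f -> lp m p g ->
  cavg k (fun y => a * f y + g y) = (fun x => a * cavg k f x + cavg k g x).
Proof.
move=> p1 fl gl; apply/funext => x; rewrite /cavg.
rewrite (@eq_csum _ _ _ (fun y => a * (real_complex R (k x y) * f y) +
   real_complex R (k x y) * g y)); last first.
  by move=> y; rewrite mulrDr mulrCA.
have F := kernel_csummable x p1 fl; have G := kernel_csummable x p1 gl.
rewrite csumD//; last exact: csummableZ.
by rewrite csumZ// mulrDr mulrCA.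
Qed.

Lemma mass_cavg p f : 1 < p -> lp m p f ->
  (lp_mass m p (cavg k f) <= (2 `^ p)%:E * lp_mass m p f)%E.
Proof.
move=> p1 fl; have p0 : 0 <= p by lra.
apply: le_trans (mass_avg_le m_gt0 kk p1 (fun y => normc_ge0 (f y)) fl).
by apply: le_mass => // x; [exact: normc_ge0|exact: normc_cavg fl].
Qed.

Lemma cavg_lp p f : 1 < p -> lp m p f -> lp m p (cavg k f).
Proof.
move=> p1 fl; apply: le_lt_trans (mass_cavg p1 fl) _.
by rewrite [lp_mass m p f](mass_fin m_gt0 fl) -EFinM ltry.
Qed.

Lemma avg_sum p (e : nat -> X -> R) N x : 1 < p ->
  (forall n y, 0 <= e n y) -> (forall n, (mass m p (e n) < +oo)%E) ->
  avg m k (fun y => \sum_(i < N) e i y) x = \sum_(i < N) avg m k (e i) x /\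
  (mass m p (fun y => \sum_(i < N) e i y)%R < +oo)%E.
Proof.
move=> p1 e0 el; have p0 : 0 < p by lra.
elim: N => [|N [IH1 IH2]].
  split; rewrite ?big_ord0.
    rewrite /avg (_ : tsum _ = 0%E) ?mulr0//.
    by rewrite (tsum_finite (s := [::])) ?big_nil// => y; rewrite big_ord0 mulr0.
  rewrite (_ : (fun _ => _) = fun=> 0) ?mass0 ?ltry//.
  by apply/funext => y; rewrite big_ord0.
have E : (fun y => \sum_(i < N.+1) e i y) =
    (fun y => \sum_(i < N) e i y + e N y).
  by apply/funext => y; rewrite big_ord_recr.
have s0 y : 0 <= \sum_(i < N) e i y by apply: sumr_ge0.
split.
  by rewrite E big_ord_recr/= -IH1 (avgD kk x p1 p1 s0 (e0 N) IH2 (el N)).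
rewrite E; apply: le_lt_trans (massD m_gt0 (ltW p0) s0 (e0 N)) _.
by rewrite (mass_fin m_gt0 IH2) (mass_fin m_gt0 (el N)) -EFinD -EFinM ltry.
Qed.

Section NeumannSeries.
Variables (lambda : C) (p : R) (h : X -> C).
Hypotheses (lambda0 : lambda != 0) (p1 : 1 < p).
Let p0 : 0 < p := lt_trans ltr01 p1.
Let c := normc lambda^-1.
Hypothesis ct : contracting m k c p.
Hypothesis hl : lp m p h.

Fixpoint neumann_term (n : nat) : X -> C :=
  if n is n'.+1 then fun x => lambda^-1 * cavg k (neumann_term n') x
  else fun x => lambda^-1 * h x.

Local Notation d := neumann_term.

Lemma lpZ a f : lp m p f -> lp m p (fun x => a * f x).
Proof.
move=> fl; rewrite /lp/= /lp_mass.
rewrite (_ : esum _ _ = mass m p (fun x => normc a * normc (f x))); last first.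
  by apply: eq_tsum => x; rewrite Normc.normcM.
rewrite massZ ?normc_ge0// => [|x]; last exact: normc_ge0.
by rewrite (mass_fin m_gt0 fl) -EFinM ltry.
Qed.

Lemma neumann_term_lp n : lp m p (d n).
Proof. by elim: n => [|n IH]; apply: lpZ => //; exact: cavg_lp. Qed.

Let e n x := normc (d n x).

Let e0 n x : 0 <= e n x. Proof. exact: normc_ge0. Qed.

Let eS n x : e n.+1 x <= c * avg m k (e n) x.
Proof.
rewrite /e /= Normc.normcM ler_wpM2l ?normc_ge0//.
exact: normc_cavg p1 (neumann_term_lp n).
Qed.

Lemma neumann_partial N x :
  \sum_(i < N) e i x <= partial m k c (e 0) N x.
Proof.
elim: N x => [|N IH] x; first by rewrite big_ord0.
rewrite big_ord_recl /= lerD2l.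
have [S1 S2] := @avg_sum p e N x p1 e0 neumann_term_lp.
apply: (@le_trans _ _ (c * avg m k (fun y => \sum_(i < N) e i y) x)).
  by rewrite S1 mulr_sumr; apply: ler_sum => i _; exact: eS.
rewrite ler_wpM2l ?normc_ge0//.
apply: (le_avg m_gt0 kk x p1) => //; first by move=> y; apply: sumr_ge0.
have c0 : 0 <= c by exact: normc_ge0.
exact: (partial_lt m_gt0 kk c0 p1 ct (e0 0) (neumann_term_lp 0)).
Qed.

Let Kp := (2 * 2 `^ p)%:E : \bar R.

Lemma neumann_partial_bound N :
  (mass m p (fun x => \sum_(i < N) e i x)%R <= Kp * mass m p (e 0))%E.
Proof.
have c0 : 0 <= c by exact: normc_ge0.
apply: le_trans (partial_bound m_gt0 kk c0 p1 ct (e0 0) (neumann_term_lp 0) N).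
apply: le_mass => //; first exact: ltW.
  by move=> x; exact: sumr_ge0.
exact: neumann_partial.
Qed.

Lemma neumann_summable x : csummable (fun n => d n x).
Proof.
pose M := fine (Kp * mass m p (e 0))%E.
have ME : (Kp * mass m p (e 0))%E = M%:E.
  by rewrite /M /Kp (mass_fin m_gt0 (neumann_term_lp 0)).
have M0 : 0 <= M.
  rewrite -lee_fin -ME; apply: mule_ge0; last exact: mass_ge0.
  by rewrite lee_fin mulr_ge0// powR_ge0.
have bnd N : \sum_(i < N) e i x <= 1 + M / m x.
  have := le_trans (mass_ge_term m_gt0 p _ x) (neumann_partial_bound N).
  rewrite ME lee_fin -ler_pdivlMr// => U.
  have [U1|U1] := leP (\sum_(i < N) e i x) 1.
    by apply: le_trans U1 _; rewrite lerDl divr_ge0// ltW.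
  apply: le_trans (le1r_powR (ltW U1) (ltW p1)) _.
  by apply: le_trans U _; rewrite lerDr.
apply: (@le_lt_trans _ _ (1 + M / m x)%:E); last by rewrite ltry.
apply: tsum_le_finite => s us; rewrite lee_fin.
pose N := (\max_(i <- s) i).+1.
apply: le_trans (bnd N).
rewrite -(big_mkord xpredT (fun i => e i x)).
apply: ler_sum_subset => //; first exact: iota_uniq.
by move=> i si; rewrite mem_index_iota /= ltnS; exact: leq_bigmax_seq.
by move=> i; exact: normc_ge0.
Qed.

(** The Neumann series converges absolutely at every vertex, because its partial
    sums of absolute values are dominated by [partial]; its sum solves the
    equation by Fubini and a shift of the index. *)
Lemma neumann_solution : exists v : X -> C,
  (lp_mass m p v <= (2 `^ p)%:E * (Kp * mass m p (e 0)))%E /\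
  (forall x, lambda * v x - cavg k v x = h x).
Proof.
pose U x := fine (tsum (fun n => e n x)).
pose v x := complex_sum (fun n => d n x).
have U0 x : 0 <= U x by rewrite fine_ge0// tsum_ge0.
have UE x : tsum (fun n => normc (d n x)) = (U x)%:E.
  by rewrite /U -tsum_fin//; exact: neumann_summable.
have UM : (mass m p U <= (2 `^ p)%:E * (Kp * mass m p (e 0)))%E.
  apply: (mass_limit m_gt0 (u := fun N x => \sum_(i < N) e i x)) => //.
  - by move=> n x; exact: sumr_ge0.
  - by move=> x; apply: tsum_nat_half => //; exact: neumann_summable.
  - exact: neumann_partial_bound.
have Ul : (mass m p U < +oo)%E.
  by apply: le_lt_trans UM _;
    rewrite /Kp (mass_fin m_gt0 (neumann_term_lp 0)) -!EFinM ltry.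
have vU x : normc (v x) <= U x.
  by rewrite -lee_fin -UE; apply: csum_norm_le; exact: neumann_summable.
exists v; split.
  apply: le_trans UM; apply: le_mass => //; [exact: ltW|].
  by move=> x; exact: normc_ge0.
move=> x.
suff E : cavg k v x = lambda * (v x - d 0 x).
  by rewrite E /= mulrBr opprB mulrA divff// mul1r addrC subrK.
rewrite /cavg.
have -> : complex_sum (fun y => real_complex R (k x y) * v y) =
    complex_sum (fun y => complex_sum (fun n => real_complex R (k x y) * d n y)).
  apply: eq_csum => y; rewrite csumZ//; exact: neumann_summable.
rewrite csum_exchange; last first.
  apply: le_lt_trans (kernel_sum_lt kk x p1 U0 Ul).
  apply: le_esum => y _.
  under eq_tsum do rewrite normc_kernel.
  rewrite tsumZ ?UE ?EFinM// => n; exact: normc_ge0.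
rewrite /v (csum_nat_recl (neumann_summable x)) addrC addKr.
have Sx : csummable (fun n => d n.+1 x).
  apply: le_lt_trans (neumann_summable x).
  by rewrite (tsum_nat_recl (fun n => e0 n x)) leeDr// lee_fin.
have mx0 : real_complex R (m x) != 0.
  by rewrite fmorph_eq0; exact: lt0r_neq0.
rewrite (@eq_csum _ _ _ (fun n => lambda * real_complex R (m x) * d n.+1 x)).
  rewrite csumZ// fmorphV mulrA; congr (_ * _).
  by rewrite mulrCA mulVf ?mulr1.
move=> n; rewrite /= /cavg fmorphV mulrA -(mulrA lambda).
rewrite (mulrC (real_complex R (m x))) (mulrA lambda) divff// mul1r mulrA.
by rewrite divff// mul1r.
Qed.

End NeumannSeries.
End Fixed.
End ComplexAverage.

(** * Independence of the exponent *)

Section Transfer.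
Variable R : realType.
Local Notation C := R[i].
Local Notation normc := Normc.normc.
Variables (X : countType) (m : X -> R).
Hypothesis m_gt0 : forall x, 0 < m x.

Definition lp_rmass (p : R) (f : X -> C) : R := fine (lp_mass m p f).

Lemma lp_rmass_ge0 p f : 0 <= lp_rmass p f.
Proof. by rewrite fine_ge0//; exact: mass_ge0. Qed.

Lemma lp_rmassE p f : lp m p f -> lp_mass m p f = (lp_rmass p f)%:E.
Proof. exact: mass_fin. Qed.

Lemma lp_le p f (u : X -> R) : 0 < p -> (forall x, normc (f x) <= u x) ->
  (mass m p u < +oo)%E -> lp m p f /\ lp_rmass p f <= fine (mass m p u).
Proof.
move=> p0 fu ul.
have h : (lp_mass m p f <= mass m p u)%E.
  by apply: le_mass => //; [exact: ltW|move=> x; exact: normc_ge0].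
have fl : lp m p f by apply: le_lt_trans ul.
by split => //; rewrite -lee_fin -lp_rmassE// -mass_fin.
Qed.

Lemma lpD p f g : 0 < p -> lp m p f -> lp m p g ->
  lp m p (fun x => f x + g x) /\
  lp_rmass p (fun x => f x + g x) <= 2 `^ p * (lp_rmass p f + lp_rmass p g).
Proof.
move=> p0 fl gl.
have h := massD m_gt0 (ltW p0) (fun x => normc_ge0 (f x)) (fun x => normc_ge0 (g x)).
have E : ((2 `^ p)%:E * (mass m p (fun x => normc (f x)) +
     mass m p (fun x => normc (g x))) = (2 `^ p * (lp_rmass p f + lp_rmass p g))%:E)%E.
  by rewrite [mass m p (fun x => normc (f x))](lp_rmassE fl)
    [mass m p (fun x => normc (g x))](lp_rmassE gl).
rewrite E in h.
have [|? le] := lp_le p0 (fun x => normc_triangle (f x) (g x)).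
  by apply: le_lt_trans h _; rewrite ltry.
split=> //; apply: le_trans le _; rewrite -lee_fin -mass_fin//.
by apply: le_lt_trans h _; rewrite ltry.
Qed.

Lemma lp_rmassZ p a f : lp m p f -> lp_rmass p (fun x => a * f x) = normc a `^ p * lp_rmass p f.
Proof.
move=> fl; rewrite /lp_rmass /lp_mass.
rewrite (_ : esum _ _ = mass m p (fun x => normc a * normc (f x))); last first.
  by apply: eq_tsum => x; rewrite Normc.normcM.
rewrite massZ ?normc_ge0// => [|x]; last exact: normc_ge0.
by rewrite [mass m p (fun x => normc (f x))](lp_rmassE fl).
Qed.

Lemma lpB p f g : 0 < p -> lp m p f -> lp m p g ->
  lp m p (fun x => f x - g x) /\
  lp_rmass p (fun x => f x - g x) <= 2 `^ p * (lp_rmass p f + lp_rmass p g).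
Proof.
move=> p0 fl gl; have gl' := lpZ m_gt0 (-1) gl.
have := lpD p0 fl gl'; rewrite lp_rmassZ// normc_opp Normc.normc1 powR1 mul1r.
by under eq_fun do rewrite mulN1r.
Qed.

Lemma finite_support_mass p (u : X -> R) (s : seq X) : 0 < p ->
  (forall x, x \notin s -> u x = 0) -> (mass m p u < +oo)%E.
Proof.
move=> p0 us; rewrite /mass (tsum_finite (s := undup s)) ?ltry ?undup_uniq//.
  by move=> x; rewrite mulr_ge0 ?powR_ge0// ltW.
by move=> x; rewrite mem_undup => /us ->; rewrite powR0 ?mul0r ?gt_eqF.
Qed.

Lemma mass_add_lt p f g : 0 < p -> (forall x, 0 <= f x) -> (forall x, 0 <= g x) ->
  (mass m p f < +oo)%E -> (mass m p g < +oo)%E ->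
  (mass m p (fun x => f x + g x)%R < +oo)%E.
Proof.
move=> p0 f0 g0 fl gl; apply: le_lt_trans (massD m_gt0 (ltW p0) f0 g0) _.
by rewrite (mass_fin m_gt0 fl) (mass_fin m_gt0 gl) -EFinD -EFinM ltry.
Qed.

Lemma mass_scale_lt p c f : 0 <= c -> (forall x, 0 <= f x) ->
  (mass m p f < +oo)%E -> (mass m p (fun x => c * f x)%R < +oo)%E.
Proof.
by move=> c0 f0 fl; rewrite massZ// (mass_fin m_gt0 fl) -EFinM ltry.
Qed.

Variables (b : X -> X -> R).
Hypothesis bm : sub_markov m b.
Let b0 := sub_markov_ge0 bm.

Lemma compress_sub_markov (D : pred X) : sub_markov m (compress D b).
Proof.
split=> [x y|x|y].
- by rewrite /compress; case: ifP.
- apply: le_trans (sub_markov_row bm x); apply: le_tsum => y.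
  by rewrite /compress; case: ifP.
- apply: le_trans (sub_markov_col bm y); apply: le_tsum => x.
  by rewrite /compress; case: ifP.
Qed.

Definition shifted (lambda : C) (f : X -> C) (x : X) : C :=
  lambda * f x - cavg m b f x.

Lemma shifted_linear p lambda a f g : 1 < p -> lp m p f -> lp m p g ->
  shifted lambda (fun x => a * f x + g x) =
  (fun x => a * shifted lambda f x + shifted lambda g x).
Proof.
move=> p1 fl gl; apply/funext => x.
rewrite /shifted (cavg_linear bm a p1 fl gl); ring.
Qed.

Lemma lp_rmass_cavg p f : 1 < p -> lp m p f -> lp_rmass p (cavg m b f) <= 2 `^ p * lp_rmass p f.
Proof.
move=> p1 fl; have := mass_cavg m_gt0 bm p1 fl.
by rewrite !lp_rmassE//; exact: (cavg_lp m_gt0 bm p1).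
Qed.

Lemma lp_shifted p lambda f : 1 < p -> lp m p f -> lp m p (shifted lambda f).
Proof.
move=> p1 fl; have p0 : 0 < p by lra.
apply: (proj1 (lpB p0 _ _)); first exact: lpZ.
exact: (cavg_lp m_gt0 bm p1).
Qed.

Definition injective_on (p : R) (lambda : C) : Prop :=
  forall f, lp m p f -> shifted lambda f = (fun=> 0) -> f = (fun=> 0).

Definition surjective_on (p : R) (lambda : C) : Prop :=
  forall g, lp m p g -> exists2 f, lp m p f & shifted lambda f = g.

Section Off.
Variables (K : seq X) (lambda : C).
Hypothesis lambda0 : lambda != 0.
Let D : pred X := fun x => x \notin K.
Let c := normc lambda^-1.
Let c0 : 0 <= c. Proof. exact: normc_ge0. Qed.
Let kk := compress_sub_markov D.

(** Off the finite set [K] the absolute value of a solution is a subsolution for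
    the compressed kernel. What comes from the values of [f] on [K] enters the
    right-hand side as the average of a finitely supported function, and such an
    average lies in every [l^r]. *)
Lemma shifted_regularity p r f g : 1 < p -> 1 < r ->
  contracting m (compress D b) c p -> contracting m (compress D b) c r ->
  lp m p f -> lp m r g -> shifted lambda f = g -> lp m r f.
Proof.
move=> p1 r1 ctp ctr fl gl fg.
have p0 : 0 < p by lra. have r0 : 0 < r by lra.
pose v x := if D x then normc (f x) else 0.
pose w x := if D x then 0 else normc (f x).
have v0 x : 0 <= v x by rewrite /v; case: ifP => // _; exact: normc_ge0.
have w0 x : 0 <= w x by rewrite /w; case: ifP => // _; exact: normc_ge0.
have vw x : normc (f x) = v x + w x.
  by rewrite /v /w; case: ifP; rewrite ?addr0 ?add0r.
have wl q : 0 < q -> (mass m q w < +oo)%E.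
  by move=> q0; apply: (@finite_support_mass _ _ K) => // x xK; rewrite /w /D xK.
have vl : (mass m p v < +oo)%E.
  apply: le_lt_trans fl; apply: le_mass => //; first exact: ltW.
  by move=> x; rewrite vw lerDl.
pose h x := c * (avg m b w x + normc (g x)).
have bw0 x : 0 <= avg m b w x by exact: (avg_ge0 m_gt0 bm).
have h0 x : 0 <= h x by rewrite mulr_ge0// addr_ge0// normc_ge0.
have bwl : (mass m r (avg m b w) < +oo)%E.
  have := mass_avg_le m_gt0 bm r1 w0 (wl r r0).
  by rewrite (mass_fin m_gt0 (wl r r0)) -EFinM => /le_lt_trans; apply; rewrite ltry.
have hl : (mass m r h < +oo)%E.
  apply: mass_scale_lt => // [x|]; first by rewrite addr_ge0// normc_ge0.
  by apply: mass_add_lt => // x; exact: normc_ge0.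
have vB x : v x <= h x + c * avg m (compress D b) v x.
  have [Dx|nDx] := boolP (D x); last first.
    rewrite {1}/v (negbTE nDx) addr_ge0// mulr_ge0//.
    exact: (avg_ge0 m_gt0 kk).
  have E : f x = lambda^-1 * (g x + cavg m b f x).
    by rewrite -fg /shifted subrK mulKf.
  rewrite {1}/v Dx E Normc.normcM -/c -mulrDr ler_wpM2l//.
  apply: le_trans (normc_triangle _ _) _.
  rewrite addrC addrAC lerD2r.
  apply: le_trans (normc_cavg m_gt0 bm x p1 fl) _.
  rewrite (_ : (fun y => normc (f y)) = fun y => v y + w y); last first.
    by apply/funext.
  rewrite (avgD bm x p1 p1 v0 w0 vl (wl p p0)) [leLHS]addrC lerD2l.
  rewrite le_eqVlt; apply/orP; left; apply/eqP; rewrite /avg; congr (_ * fine _).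
  apply: eq_tsum => y; rewrite /compress Dx /v.
  by case: (D y); rewrite //= !mulr0.
have := mass_regularity m_gt0 kk c0 p1 r1 ctp ctr v0 h0 vl hl vB.
rewrite (mass_fin m_gt0 hl) -EFinM => vr.
have vrl : (mass m r v < +oo)%E by apply: le_lt_trans vr _; rewrite ltry.
apply: (proj1 (lp_le r0 _ (mass_add_lt r0 v0 w0 vrl (wl r r0)))).
by move=> x; rewrite vw.
Qed.

Lemma finite_support_lp p g (s : seq X) : 0 < p ->
  (forall x, x \notin s -> g x = 0) -> lp m p g.
Proof.
move=> p0 gs; apply: (@finite_support_mass p _ s p0) => x /gs ->.
exact: Normc.normc0.
Qed.

(** Solutions for the point masses come from solvability in [l^p], and regularity
    moves them to [l^r]; finitely many of them give a bounded solution operator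
    for right-hand sides supported on a given finite list. *)
Lemma solve_finite_support p r : 1 < p -> 1 < r ->
  contracting m (compress D b) c p -> contracting m (compress D b) c r ->
  surjective_on p lambda -> forall s : seq X,
  exists2 M, 0 <= M & forall g, (forall x, x \notin s -> g x = 0) ->
    exists f, [/\ lp m r f, shifted lambda f = g & lp_rmass r f <= M * lp_rmass r g].
Proof.
move=> p1 r1 ctp ctr surj; have p0 : 0 < p by lra. have r0 : 0 < r by lra.
have t0 : 0 < 2 `^ r :> R by exact: powR_gt0.
have cavg0 : cavg m b (fun=> 0) = (fun=> 0).
  have l0 : lp m r (fun=> 0) by apply: (@finite_support_lp r _ [::]).
  have := cavg_linear bm (-1) r1 l0 l0.
  rewrite (_ : (fun y => _) = fun=> 0); last by apply/funext => y; rewrite mulr0 add0r.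
  by move=> ->; apply/funext => y; rewrite mulN1r addNr.
elim=> [|x0 s [M M0 IH]].
  exists 0 => // g g0; have -> : g = (fun=> 0) by apply/funext => x; exact: g0.
  have l0 : lp m r (fun=> 0) by apply: (@finite_support_lp r _ [::]).
  exists (fun=> 0); split => //.
    by apply/funext => x; rewrite /shifted cavg0 mulr0 subr0.
  by rewrite mul0r /lp_rmass /lp_mass -/(tsum _) (tsum_finite (s := [::]))
    ?big_nil// => x; rewrite Normc.normc0 powR0 ?mul0r ?gt_eqF.
pose delta x : C := if x == x0 then 1 else 0.
have dl q : 0 < q -> lp m q delta.
  move=> q0; apply: (@finite_support_lp q _ [:: x0]) => // x.
  by rewrite inE /delta => /negbTE ->.
have [e el ee] := surj delta (dl p p0).
have el' : lp m r e := shifted_regularity p1 r1 ctp ctr el (dl r r0) ee.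
exists (2 `^ r * (lp_rmass r e / m x0 + M)).
  by rewrite mulr_ge0 ?addr_ge0// ?powR_ge0// divr_ge0 ?lp_rmass_ge0// ltW.
move=> g gs.
have gl : lp m r g by apply: (@finite_support_lp r _ (x0 :: s)).
pose g' x := if x == x0 then 0 else g x.
have [|f [fl fg fM]] := IH g'.
  by move=> x xs; rewrite /g'; case: eqVneq => // xx0; rewrite gs// inE negb_or xx0.
have [l1 l2] := lpD r0 (lpZ m_gt0 (g x0) el') fl.
exists (fun x => g x0 * e x + f x); split => //.
  rewrite (shifted_linear _ _ r1 el' fl) ee fg; apply/funext => x.
  by rewrite /delta /g'; case: eqVneq => [->|_]; rewrite ?mulr1 ?addr0 ?mulr0 ?add0r.
apply: le_trans l2 _; rewrite -[leRHS]mulrA ler_wpM2l ?(ltW t0)// lp_rmassZ//.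
rewrite [leRHS]mulrDl lerD//.
  have : normc (g x0) `^ r * m x0 <= lp_rmass r g.
    by rewrite -lee_fin -lp_rmassE//; exact: (mass_ge_term m_gt0).
  rewrite -ler_pdivlMr// => h.
  rewrite -mulrA mulrC ler_wpM2l ?lp_rmass_ge0//.
  by rewrite (mulrC (m x0)^-1).
apply: le_trans fM _; rewrite ler_wpM2l//.
rewrite -lee_fin -!lp_rmassE//; last first.
  apply: (@finite_support_lp r _ s) => // x xs.
  by rewrite /g'; case: eqVneq => // xx0; rewrite gs// inE negb_or xx0.
apply: le_mass => //; [exact: ltW|by move=> x; exact: normc_ge0|].
by move=> x; rewrite /g'; case: ifP => // _; rewrite Normc.normc0 normc_ge0.
Qed.

(** The Neumann series for the compressed kernel solves the equation off [K], and
    what remains is supported on the finite list [K]. *)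
Lemma solve_all p r : 1 < p -> 1 < r ->
  contracting m (compress D b) c p -> contracting m (compress D b) c r ->
  surjective_on p lambda ->
  exists M, forall g, lp m r g ->
    exists f, [/\ lp m r f, shifted lambda f = g & lp_rmass r f <= M * lp_rmass r g].
Proof.
move=> p1 r1 ctp ctr surj; have r0 : 0 < r by lra.
have [M M0 fin] := solve_finite_support p1 r1 ctp ctr surj K.
pose t : R := 2 `^ r; pose l := normc lambda `^ r.
have t0 : 0 <= t by exact: powR_ge0.
have l0 : 0 <= l by exact: powR_ge0.
pose A := t * (2 * t * c `^ r).
have A0 : 0 <= A by rewrite !mulr_ge0 ?powR_ge0.
exists (t * (A + M * (t * (1 + t * (l * A + t * A))))) => g gl.
pose h x := if D x then g x else 0.
have hM : lp m r h /\ lp_rmass r h <= lp_rmass r g.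
  apply: lp_le => // x.
  by rewrite /h; case: ifP => // _; rewrite Normc.normc0 normc_ge0.
have [hl hg] := hM.
have [v [vM vh]] := neumann_solution m_gt0 kk lambda0 r1 ctr hl.
have iM : ((2 `^ r)%:E * ((2 * 2 `^ r)%:E * mass m r
    (fun x => normc (neumann_term m (compress D b) lambda h 0 x))) =
    (A * lp_rmass r h)%:E)%E.
  rewrite [mass _ _ _](lp_rmassE (lpZ m_gt0 lambda^-1 hl)) lp_rmassZ// -!EFinM /A.
  by congr _%:E; rewrite /t /c; ring.
rewrite iM in vM.
have vl : lp m r v by apply: le_lt_trans vM _; rewrite ltry.
have vA : lp_rmass r v <= A * lp_rmass r g.
  by rewrite lp_rmassE// lee_fin in vM; apply: le_trans vM _; rewrite ler_wpM2l.
have vD x : ~~ D x -> v x = 0.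
  move=> nDx; apply: (mulfI lambda0); rewrite mulr0.
  have := vh x; rewrite {1}/h (negbTE nDx) /cavg (_ : complex_sum _ = 0).
    by rewrite mulr0 subr0.
  rewrite (@eq_csum _ _ _ (fun=> 0)).
    by rewrite /complex_sum/= /real_sum oppr0 subrr.
  by move=> y; rewrite /compress (negbTE nDx) rmorph0 mul0r.
pose rho x := g x - shifted lambda v x.
have [rl1 rl2] := lpB r0 gl (lp_shifted lambda r1 vl).
have [|f [fl ff fM]] := fin rho.
  move=> x xK; have Dx : D x by [].
  rewrite /rho /shifted; have := vh x; rewrite /h Dx => <-.
  suff -> : cavg m (compress D b) v x = cavg m b v x by rewrite subrr.
  rewrite /cavg; congr (_ * _); apply: eq_csum => y; rewrite /compress Dx/=.
  by case: ifP => //= /negbT /vD ->; rewrite !mulr0.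
have [sl1 sl2] := lpD r0 vl fl.
exists (fun x => v x + f x); split => //.
  have := shifted_linear lambda 1 r1 vl fl.
  rewrite (_ : (fun x => _) = (fun x => v x + f x)); last first.
    by apply/funext => x; rewrite mul1r.
  by move=> ->; rewrite ff; apply/funext => x; rewrite mul1r /rho subrKC.
have [_ Tv] := lpB r0 (lpZ m_gt0 lambda vl) (cavg_lp m_gt0 bm r1 vl).
rewrite lp_rmassZ// -/l -/t in Tv.
have Pv := lp_rmass_cavg r1 vl; rewrite -/t in Pv.
clear iM vM; clearbody A.
have v0 := lp_rmass_ge0 r v; have g0 := lp_rmass_ge0 r g.
have P1 : lp_rmass r (shifted lambda v) <= t * (l * A + t * A) * lp_rmass r g.
  apply: le_trans Tv _; rewrite -mulrA ler_wpM2l// mulrDl -!mulrA.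
  rewrite lerD ?ler_wpM2l//; apply: le_trans Pv _; exact: ler_wpM2l.
apply: le_trans sl2 _; rewrite -/t -mulrA ler_wpM2l// mulrDl lerD//.
apply: le_trans fM _; rewrite -mulrA ler_wpM2l//.
apply: le_trans rl2 _; rewrite -/t -mulrA ler_wpM2l// mulrDl mul1r lerD2l.
exact: P1.
Qed.

Lemma injective_transfer p r : 1 < p -> 1 < r ->
  contracting m (compress D b) c p -> contracting m (compress D b) c r ->
  injective_on p lambda -> injective_on r lambda.
Proof.
move=> p1 r1 ctp ctr inj f fl f0; apply: (inj f _ f0).
apply: (shifted_regularity r1 p1 ctr ctp fl _ f0).
by apply: (@finite_support_lp p _ [::]) => //; lra.
Qed.

End Off.

Lemma contracting_small p delta lambda k : 1 < p -> lambda != 0 ->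
  sub_markov m k ->
  (normc lambda^-1) `^ p * delta <= (2 `^ p)^-1 * 2^-1 ->
  (forall f, (forall y, 0 <= f y) -> (mass m p f < +oo)%E ->
     (mass m p (avg m k f) <= delta%:E * mass m p f)%E) ->
  contracting m k (normc lambda^-1) p.
Proof.
move=> p1 l0 kk dl h f f0 fl; rewrite massZ ?normc_ge0//; last first.
  by move=> x; exact: (avg_ge0 m_gt0 kk).
apply: le_trans (lee_wpmul2l _ (h f f0 fl)) _; first by rewrite lee_fin powR_ge0.
by rewrite muleA -EFinM lee_wpmul2r ?mass_ge0// lee_fin.
Qed.

Lemma contracting_compress p lambda : 1 < p -> lambda != 0 ->
  exists2 eta, 0 < eta & forall D : pred X, coarea_bound m (compress D b) eta ->
    contracting m (compress D b) (normc lambda^-1) p.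
Proof.
move=> p1 l0; have n0 : 0 < normc lambda^-1.
  rewrite lt_neqAle normc_ge0 andbT eq_sym; apply: contra_neq l0.
  by move=> /Normc.eq0_normc /eqP; rewrite invr_eq0 => /eqP.
have c0 : 0 < (normc lambda^-1) `^ p by exact: powR_gt0.
have t0 : 0 < (2 : R) `^ p by exact: powR_gt0.
pose delta := (2 `^ p)^-1 * 2^-1 / (normc lambda^-1) `^ p.
have d0 : 0 < delta by rewrite divr_gt0// mulr_gt0 ?invr_gt0.
have [eta e0 h] := mass_avg_small m_gt0 p1 d0; exists eta => // D co.
apply: (contracting_small (delta := delta)) => //; first exact: compress_sub_markov.
  by rewrite /delta mulrC divfK// gt_eqF.
exact: h (compress_sub_markov D) co.
Qed.

End Transfer.

(** * The resolvent set of the Laplacian *)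

Section GraphSpectrum.
Variable R : realType.
Local Notation C := R[i].
Local Notation normc := Normc.normc.
Variables (X : countType) (m : X -> R) (G : graph m).
Hypothesis m_gt0 : forall x, 0 < m x.
Hypothesis m_eq_deg : forall x, (m x)%:E = deg G x.

Local Notation b := (edge_weight G).

Lemma tsum_edge x : tsum (b x) = (m x)%:E.
Proof. by rewrite m_eq_deg. Qed.

Lemma graph_sub_markov : sub_markov m b.
Proof.
split; [exact: edge_weight_ge0|by move=> x; rewrite tsum_edge|].
move=> y; rewrite -tsum_edge; apply: le_tsum => x.
by rewrite edge_weight_sym.
Qed.

Lemma edge_weight_le x y : b x y <= m x.
Proof. by rewrite -lee_fin -tsum_edge; apply: tsum_term; exact: edge_weight_ge0. Qed.

(** The volume of [W] is the weight inside [W] plus that of the boundary, so a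
    Cheeger constant close to 1 leaves little weight inside. *)
Lemma isoperimetric_outside_finite eta : 0 < eta -> cheeger_infty G = 1%:E ->
  exists K : seq X, forall s, uniq s -> all (fun x => x \notin K) s ->
    \sum_(x <- s) \sum_(y <- s) b x y <= eta * \sum_(x <- s) m x.
Proof.
move=> e0 al.
have : ((1 - eta)%:E < cheeger_infty G)%E by rewrite al lte_fin; lra.
move=> /ereal_sup_gt[_ [beta [beta0 [K [fK iso]]] <-]]; rewrite lte_fin => eb.
exists (fset_set K) => s us Ks.
have sK : [set` s] `<=` ~` K.
  move=> x /= xs Kx; have := allP Ks x xs.
  by rewrite in_fset_set// mem_set.
have := iso [set` s] (finite_seq s) sK.
have vol : deg_vol G [set` s] = (\sum_(x <- s) m x)%:E.
  rewrite /deg_vol (esum_fset (finite_seq s)) => [|x _]; last first.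
    by rewrite -m_eq_deg lee_fin ltW.
  rewrite -fsbig_seq//= -sumEFin; apply: eq_bigr => x _; exact/esym/m_eq_deg.
have bnd : ((\sum_(x <- s) \sum_(y <- s) b x y)%:E + boundary G [set` s] =
    (\sum_(x <- s) m x)%:E)%E.
  have be0 (x y : X) : (0 <= (b x y)%:E)%E by rewrite lee_fin edge_weight_ge0.
  rewrite /boundary (_ : _ `*` _ = [set` s] `*`` (fun=> ~` [set` s])); last first.
    by apply/seteqP; split=> -[x y].
  rewrite -(@esum_esum _ _ _ _ _ (fun x y => (b x y)%:E))//.
  rewrite (esum_fset (finite_seq s)) => [|x _]; last exact: esum_ge0.
  rewrite -fsbig_seq//= -sumEFin -big_split/= -sumEFin; apply: eq_bigr => x _.
  rewrite -tsum_edge /tsum [RHS](esumID [set` s])// !setTI; congr (_ + _)%E.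
  by rewrite (esum_fset (finite_seq s))// -fsbig_seq//= sumEFin.
rewrite vol => h.
have : ((\sum_(x <- s) \sum_(y <- s) b x y)%:E + beta%:E * (\sum_(x <- s) m x)%:E
    <= (\sum_(x <- s) m x)%:E)%E by rewrite -[X in (_ <= X)%E]bnd leeD2l.
rewrite -EFinM -EFinD lee_fin => h2.
have : 0 <= \sum_(x <- s) m x by apply: sumr_ge0 => x _; exact: ltW.
by nra.
Qed.

Lemma coarea_outside_finite eta : 0 < eta -> cheeger_infty G = 1%:E ->
  exists K : seq X, coarea_bound m (compress (fun x => x \notin K) b) eta.
Proof.
move=> e0 /(isoperimetric_outside_finite e0)[K iso]; exists K.
by apply: coarea_compress => //; [exact: edge_weight_ge0|move=> x|]; exact: ltW.
Qed.

Lemma coarea_bound_le (k : X -> X -> R) eta eta' : eta <= eta' ->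
  coarea_bound m k eta -> coarea_bound m k eta'.
Proof.
move=> ee h H H0; apply: le_trans (h H H0) _.
rewrite lee_wpmul2r ?lee_fin// tsum_ge0// => x.
by rewrite mulr_ge0// ltW.
Qed.

Hypothesis alpha : cheeger_infty G = 1%:E.

Lemma bijective_transfer p r lambda : 1 < p -> 1 < r -> lambda != 0 ->
  injective_on m b p lambda -> surjective_on m b p lambda ->
  injective_on m b r lambda /\
  exists M, forall g, lp m r g ->
    exists f, [/\ lp m r f, shifted m b lambda f = g & lp_rmass m r f <= M * lp_rmass m r g].
Proof.
move=> p1 r1 l0 inj surj; have bm := graph_sub_markov.
have [e1 e10 h1] := contracting_compress m_gt0 bm p1 l0.
have [e2 e20 h2] := contracting_compress m_gt0 bm r1 l0.
have [|K co] := @coarea_outside_finite (Num.min e1 e2) _ alpha; first by rewrite lt_min e10.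
have ctp : contracting m (compress (fun x => x \notin K) b) (normc lambda^-1) p.
  by apply/h1/coarea_bound_le/co; rewrite ge_min lexx.
have ctr : contracting m (compress (fun x => x \notin K) b) (normc lambda^-1) r.
  by apply/h2/coarea_bound_le/co; rewrite ge_min lexx orbT.
split; first exact: (injective_transfer m_gt0 bm l0 p1 r1 ctp ctr inj).
exact: (solve_all m_gt0 bm l0 p1 r1 ctp ctr surj).
Qed.

Hypothesis c_eq0 : forall x, killing G x = 0.

Lemma laplacianE p f x : 1 < p -> lp m p f ->
  laplacian G f x = f x - cavg m b f x.
Proof.
move=> p1 fl; have bm := graph_sub_markov.
rewrite /laplacian c_eq0 mul0r addr0 /cavg.
have S := kernel_csummable bm x p1 fl.
have Sb : csummable (fun y => real_complex R (b x y)).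
  rewrite /csummable (@eq_tsum _ _ _ (b x)) ?tsum_edge ?ltry// => y.
  by rewrite normc_real ger0_norm// edge_weight_ge0.
rewrite (@eq_csum _ _ _ (fun y => f x * real_complex R (b x y) +
   (-1) * (real_complex R (b x y) * f y))); last by move=> y; ring.
rewrite csumD; [|exact: csummableZ|exact: csummableZ].
rewrite !csumZ// (_ : complex_sum (fun y => real_complex R (b x y)) =
  real_complex R (m x)).
  rewrite mulrDr mulrCA -rmorphM mulVf ?rmorph1 ?mulr1 ?lt0r_neq0//.
  by rewrite mulN1r mulrN.
rewrite /complex_sum /=; congr Complex.
  rewrite (_ : (fun y => b x y) = fun y => b x y - 0); last first.
    by apply/funext => y; rewrite subr0.
  have z0 : tsum (fun _ : X => 0 : R) = 0%E by apply: esum1.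
  rewrite real_sumB ?z0 ?subr0 ?tsum_edge ?ltry//.
  by move=> y; exact: edge_weight_ge0.
by rewrite /real_sum oppr0 subrr.
Qed.

Lemma shiftedE p z f : 1 < p -> lp m p f ->
  (fun x => z * f x - laplacian G f x) = (fun x => - shifted m b (1 - z) f x).
Proof.
move=> p1 fl; apply/funext => x; rewrite (laplacianE x p1 fl) /shifted; ring.
Qed.

Lemma resolvent_bijective p z : 1 < p ->
  resolvent_set m p (laplacian G) z ->
  injective_on m b p (1 - z) /\ surjective_on m b p (1 - z).
Proof.
move=> p1 [S [Slp Slin _] Sinv]; split.
  move=> f fl f0; have [Sf _] := Sinv f fl.
  rewrite (shiftedE z p1 fl) f0 in Sf.
  rewrite -Sf (_ : (fun x => - _) = fun=> 0); last by apply/funext => x; rewrite oppr0.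
  have l0 : lp m p (fun=> 0) by apply: (@finite_support_lp _ _ _ m_gt0 _ _ [::]) => //; lra.
  have := Slin (-1) _ _ l0 l0.
  rewrite (_ : (fun x => -1 * 0 + 0) = fun=> 0); last first.
    by apply/funext => x; rewrite mulr0 addr0.
  by move=> ->; apply/funext => x; rewrite mulN1r addNr.
move=> g gl; have gl' : lp m p (fun x => -1 * g x) by exact: lpZ.
have [_ Sg] := Sinv _ gl'.
exists (S (fun x => -1 * g x)); first exact: Slp.
apply/funext => x; have := congr1 (@^~ x) Sg.
have := congr1 (@^~ x) (shiftedE z p1 (Slp _ gl')) => /= -> /(congr1 -%R).
by rewrite opprK mulN1r opprK.
Qed.

(** By injectivity, solutions chosen with a norm bound depend linearly on the
    right-hand side. *)
Lemma bijective_resolvent p z M : 1 < p ->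
  injective_on m b p (1 - z) ->
  (forall g, lp m p g -> exists f,
    [/\ lp m p f, shifted m b (1 - z) f = g & lp_rmass m p f <= M * lp_rmass m p g]) ->
  resolvent_set m p (laplacian G) z.
Proof.
move=> p1 inj surj; have p0 : 0 < p by lra.
have bm := graph_sub_markov.
have [S HS] : {S : (X -> C) -> (X -> C) & forall g, lp m p g ->
    [/\ lp m p (S g), shifted m b (1 - z) (S g) = (fun x => -1 * g x) &
        lp_rmass m p (S g) <= M * lp_rmass m p g]}.
  apply: (@choice _ _ (fun g f => lp m p g -> [/\ lp m p f,
    shifted m b (1 - z) f = (fun x => -1 * g x) & lp_rmass m p f <= M * lp_rmass m p g])).
  move=> g; have [gl|ngl] := pselect (lp m p g); last by exists g => /ngl.
  have [f [fl ff fM]] := surj _ (lpZ m_gt0 (-1) gl).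
  exists f => _; split => //; apply: le_trans fM _.
  by rewrite lp_rmassZ// normc_opp Normc.normc1 powR1 mul1r.
have uniq f f' : lp m p f -> lp m p f' ->
    shifted m b (1 - z) f = shifted m b (1 - z) f' -> f = f'.
  move=> fl fl' E; have := inj (fun x => -1 * f' x + f x).
  have l : lp m p (fun x => -1 * f' x + f x).
    by apply: (proj1 (lpD m_gt0 p0 _ fl)); exact: lpZ.
  move=> /(_ l); rewrite (shifted_linear bm _ _ p1 fl' fl) E => h.
  apply/funext => x.
  have : -1 * f' x + f x = 0.
    apply: (congr1 (@^~ x) (h _)).
    by apply/funext => y; rewrite mulN1r addNr.
  by rewrite mulN1r addrC => /eqP; rewrite subr_eq0 => /eqP.
exists S; first split.
- by move=> f /HS[].
- move=> a f g fl gl; have [Sf1 Sf2 _] := HS f fl; have [Sg1 Sg2 _] := HS g gl.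
  have l : lp m p (fun x => a * f x + g x).
    by apply: (proj1 (lpD m_gt0 p0 _ gl)); exact: lpZ.
  have [S1 S2 _] := HS _ l.
  apply: uniq => //.
    by apply: (proj1 (lpD m_gt0 p0 _ Sg1)); exact: lpZ.
  rewrite (shifted_linear bm _ _ p1 Sf1 Sg1) S2 Sf2 Sg2.
  by apply/funext => x; ring.
- exists (`|M| `^ p^-1) => f fl; have [Sf1 _ Sf3] := HS f fl.
  rewrite /lp_norm -!/(lp_rmass m p _) -powRM ?lp_rmass_ge0//.
  rewrite ge0_ler_powR ?nnegrE ?invr_ge0 ?(ltW p0) ?lp_rmass_ge0 ?mulr_ge0 ?lp_rmass_ge0//.
  by apply: le_trans Sf3 _; rewrite ler_wpM2r ?lp_rmass_ge0// ler_norm.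
move=> f fl; rewrite (shiftedE z p1 fl).
have Tl := lp_shifted m_gt0 bm (1 - z) p1 fl.
have [Sf1 Sf2 _] := HS f fl; split.
  have l : lp m p (fun x => - shifted m b (1 - z) f x).
    by have := lpZ m_gt0 (-1) Tl; under eq_fun do rewrite mulN1r.
  have [S1 S2 _] := HS _ l; apply: uniq => //; rewrite S2.
  by apply/funext => x; rewrite mulrN mulN1r opprK.
rewrite (shiftedE z p1 Sf1) Sf2; apply/funext => x; by rewrite mulN1r opprK.
Qed.

End GraphSpectrum.

(** * Failure of invertibility at one *)

Section NotInvertible.
Variable R : realType.
Local Notation C := R[i].
Local Notation normc := Normc.normc.
Variables (X : countType) (m : X -> R) (G : graph m).
Hypothesis m_gt0 : forall x, 0 < m x.
Hypothesis m_eq_deg : forall x, (m x)%:E = deg G x.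
Hypothesis alpha : cheeger_infty G = 1%:E.
Hypothesis c_eq0 : forall x, killing G x = 0.

Local Notation b := (edge_weight G).

(** On a finite vertex set every nonnegative number would be admissible in the supremum, with
    the whole vertex set as exceptional set. *)
Lemma infinite_vertices : infinite_set [set: X].
Proof.
move=> fX; have : (2%:E <= cheeger_infty G)%E.
  apply: ereal_sup_ubound; exists 2 => //; split => //.
  exists setT; split => // W _; rewrite setCT subset0 => ->.
  rewrite /deg_vol esum_set0 mule0; apply: esum_ge0 => e _.
  by rewrite lee_fin edge_weight_ge0.
by rewrite alpha lee_fin; lra.
Qed.

(** Each of finitely many vertices has finite total edge weight, so that it can
    be strongly linked to finitely many vertices only. *)
Lemma weakly_linked_vertex (K : seq X) eps : 0 < eps ->
  exists2 x, x \notin K & forall k, k \in K -> b k x <= eps * m k.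
Proof.
move=> e0; apply: contrapT => none.
have [e ep eK] : exists2 e, 0 < e & forall k, k \in K -> e <= eps * m k.
  elim: (K) => [|k s [e ep es]]; first by exists 1.
  exists (Num.min e (eps * m k)); first by rewrite lt_min ep mulr_gt0.
  by move=> j; rewrite inE ge_min => /predU1P[->|/es ->//]; rewrite lexx orbT.
have bad x : x \notin K -> e <= \sum_(k <- K) b k x.
  move=> xK; have [k kK kx] : exists2 k, k \in K & eps * m k < b k x.
    apply: contrapT => h; apply: none; exists x => // k kK.
    by rewrite leNgt; apply/negP => kx; apply: h; exists k.
  apply: le_trans (eK k kK) _; apply: le_trans (ltW kx) _.
  rewrite (big_rem k)//= lerDl; apply: sumr_ge0 => ? _; exact: edge_weight_ge0.
pose S := \sum_(k <- K) m k.
have S0 : 0 <= S by apply: sumr_ge0 => ? _; exact: ltW.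
pose N := Num.bound (S / e).
have SN : S / e < N%:R by apply: archi_boundP; rewrite divr_ge0// ltW.
have inf : infinite_set (~` [set` K]).
  move=> fin; apply: infinite_vertices; rewrite -(setUv [set` K]).
  by rewrite finite_setU; split => //; exact: finite_seq.
have [B BK NB] := infinite_set_fset N inf.
have : N%:R * e <= S.
  apply: (@le_trans _ _ (\sum_(x <- B) e)).
    by rewrite big_const_seq count_predT iter_addr_0 -[leRHS]mulr_natl ler_wpM2r ?(ltW ep)// ler_nat.
  apply: (@le_trans _ _ (\sum_(x <- B) \sum_(k <- K) b k x)).
    rewrite big_seq [leRHS]big_seq; apply: ler_sum => x xB; apply: bad.
    by apply/negP => xK; apply: (BK x xB).
  rewrite exchange_big/=; apply: ler_sum => k _.
  rewrite -lee_fin -(tsum_edge m_eq_deg).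
  by apply: finite_le_tsum => //; exact: edge_weight_ge0.
by move: SN; rewrite ltr_pdivrMr// => h /(lt_le_trans h); rewrite ltxx.
Qed.

Lemma avg_point (k : X -> X -> R) (x y : X) : (forall x y, 0 <= k x y) ->
  avg m k (fun z => if z == x then 1 else 0) y = (m y)^-1 * k y x.
Proof.
move=> k0; rewrite /avg; congr (_ * _).
rewrite (eq_tsum (b := fun z => if z == x then k y x else 0)) ?tsum_single//.
by move=> z; case: eqVneq => [->|_]; rewrite ?mulr1 ?mulr0.
Qed.

(** Point masses at vertices far from [K] are witnesses: off [K] their average is
    small by the co-area inequality, and on [K] because the vertex is only weakly
    linked to [K]. *)
Lemma small_average p delta : 1 < p -> 0 < delta ->
  exists f, [/\ lp m p f, 0 < lp_rmass m p f & lp_rmass m p (cavg m b f) <= delta * lp_rmass m p f].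
Proof.
move=> p1 d0; have p0 : 0 < p by lra.
have bm := graph_sub_markov m_eq_deg.
pose t : R := 2 `^ p; have t0 : 0 < t by exact: powR_gt0.
pose d := delta / t / 2.
have dp : 0 < d by rewrite !divr_gt0.
have [eta e0 small] := mass_avg_small m_gt0 p1 dp.
have [K co] := coarea_outside_finite m_gt0 m_eq_deg e0 alpha.
pose D : pred X := fun x => x \notin K.
have kD : sub_markov m (compress D b) := compress_sub_markov bm D.
pose q := d / (size K).+1%:R.
have q0 : 0 < q by rewrite divr_gt0.
(* for each vertex of [K] the average contributes at most [eps `^ (p - 1) = q] times
   an edge weight, and [q] leaves room for as many terms as [K] has *)
pose eps := q `^ (p - 1)^-1.
have ep : 0 < eps by exact: powR_gt0.
have [x xK xk] := weakly_linked_vertex K ep.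
pose ind (z : X) : R := if z == x then 1 else 0.
have ind0 z : 0 <= ind z by rewrite /ind; case: ifP.
have indM : mass m p ind = (m x)%:E.
  rewrite -[RHS](tsum_single x (ltW (m_gt0 x))); apply: eq_tsum => z.
  by rewrite /ind; case: eqVneq => [->|_]; rewrite ?powR1 ?mul1r// powR0 ?mul0r// gt_eqF.
have indl : (mass m p ind < +oo)%E by rewrite indM ltry.
pose f z : C := if z == x then 1 else 0.
have fE : (fun z => normc (f z)) = ind.
  by apply/funext => z; rewrite /f /ind; case: eqVneq; rewrite ?Normc.normc1 ?Normc.normc0.
have fM : lp_mass m p f = (m x)%:E by rewrite -indM -fE.
have fl : lp m p f by rewrite /lp/= fM ltry.
exists f; split=> //; first by rewrite /lp_rmass fM; exact: m_gt0.
rewrite {2}/lp_rmass fM /=.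
pose u1 := avg m (compress D b) ind.
pose u2 y := if D y then 0 else (m y)^-1 * b y x.
have u10 y : 0 <= u1 y by exact: (avg_ge0 m_gt0 kD).
have u20 y : 0 <= u2 y.
  by rewrite /u2; case: ifP => // _; rewrite mulr_ge0 ?edge_weight_ge0// invr_ge0 ltW.
have cu y : normc (cavg m b f y) <= u1 y + u2 y.
  apply: le_trans (normc_cavg m_gt0 bm y p1 fl) _; rewrite fE.
  rewrite /u1 /ind !avg_point; last 2 first.
  - exact: sub_markov_ge0 kD.
  - exact: edge_weight_ge0.
  rewrite /u2 /compress [D x]xK andbT; case: ifP => _; first by rewrite addr0.
  by rewrite mulr0 add0r.
have M1 : (mass m p u1 <= (d * m x)%:E)%E.
  by rewrite EFinM -indM; exact: small.
have M2 : (mass m p u2 <= (d * m x)%:E)%E.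
  rewrite /mass (tsum_finite (s := undup K)) ?undup_uniq//; last 2 first.
  - by move=> y; rewrite mulr_ge0 ?powR_ge0// ltW.
  - by move=> y; rewrite mem_undup /u2 /D => ->; rewrite powR0 ?mul0r// gt_eqF.
  rewrite lee_fin; apply: (@le_trans _ _ (\sum_(k <- undup K) q * m x)).
    rewrite big_seq [leRHS]big_seq; apply: ler_sum => k; rewrite mem_undup => kK.
    have bk := xk k kK; have b0 : 0 <= b k x by exact: edge_weight_ge0.
    have v0 : 0 <= (m k)^-1 * b k x by rewrite mulr_ge0// invr_ge0 ltW.
    rewrite /u2 /D kK /= -(mulr_powRB1 v0 p0) mulrAC.
    rewrite (mulrC (m k)^-1) divfK ?lt0r_neq0// [leLHS]mulrC.
    apply: ler_pM => //; first exact: powR_ge0.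
      have -> : q = eps `^ (p - 1) by rewrite -powRrM mulVf ?powRr1 ?ltW//; lra.
      rewrite ge0_ler_powR ?nnegrE ?(ltW ep)//; first lra.
        by rewrite divr_ge0// ltW.
      by rewrite ler_pdivrMr.
    by rewrite edge_weight_sym; exact: edge_weight_le.
  rewrite big_const_seq count_predT iter_addr_0 -[leLHS]mulr_natl mulrA.
  rewrite ler_wpM2r ?(ltW (m_gt0 x))// /q mulrCA ler_piMr ?(ltW dp)//.
  by rewrite ler_pdivrMr// mul1r ler_nat leqW// size_undup.
have bnd : (mass m p (fun y => u1 y + u2 y)%R <= (delta * m x)%:E)%E.
  apply: le_trans (massD m_gt0 (ltW p0) u10 u20) _.
  apply: le_trans (lee_wpmul2l _ (leeD M1 M2)) _; first by rewrite lee_fin powR_ge0.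
  rewrite -EFinD -EFinM lee_fin -/t -mulrDl mulrA ler_wpM2r ?(ltW (m_gt0 x))//.
  by rewrite le_eqVlt; apply/orP; left; apply/eqP; rewrite /d; field; rewrite gt_eqF.
have ul : (mass m p (fun y => u1 y + u2 y)%R < +oo)%E.
  by apply: le_lt_trans bnd _; rewrite ltry.
have [_ h] := lp_le m_gt0 p0 cu ul; apply: le_trans h _.
by rewrite -lee_fin -mass_fin.
Qed.

Lemma powR_root_le (p M u w : R) : 0 < p -> 0 <= u -> 0 <= w ->
  u `^ p^-1 <= M * w `^ p^-1 -> u <= `|M| `^ p * w.
Proof.
move=> p0 u0 w0 h.
have r1 (y : R) : 0 <= y -> (y `^ p^-1) `^ p = y.
  by move=> y0; rewrite -powRrM mulVf ?powRr1// gt_eqF.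
have ur := powR_ge0 u p^-1; have wr := powR_ge0 w p^-1.
rewrite -(r1 u u0) -(r1 w w0) -powRM//.
apply: ge0_ler_powR; rewrite ?nnegrE ?mulr_ge0 ?(ltW p0)//.
by apply: le_trans h _; rewrite ler_wpM2r// ler_norm.
Qed.

(** At 1 the operator to be inverted is the averaging operator, and
    [small_average] says that it is not bounded below. *)
Lemma one_notin_resolvent_set p : 1 < p -> ~ resolvent_set m p (laplacian G) 1.
Proof.
move=> p1 [S [Slp _ [M SM]] Sinv]; have p0 : 0 < p by lra.
pose A := `|M| `^ p + 1; have A0 : 0 < A by rewrite ltr_wpDl// powR_ge0.
have [f [fl f0 fs]] := small_average p1 (divr_gt0 ltr01 (mulr_gt0 (ltr0n R 2) A0)).
have bm := graph_sub_markov m_eq_deg.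
have Pl : lp m p (cavg m b f) by exact: (cavg_lp m_gt0 bm p1).
have [Sf _] := Sinv f fl.
have E : (fun x => 1 * f x - laplacian G f x) = cavg m b f.
  apply/funext => x; rewrite (laplacianE m_gt0 m_eq_deg c_eq0 x p1 fl); ring.
rewrite E in Sf; have := SM _ Pl; rewrite Sf /lp_norm -!/(lp_rmass m p _) => h.
have h2 : lp_rmass m p f <= `|M| `^ p * lp_rmass m p (cavg m b f).
  by apply: powR_root_le h => //; exact: lp_rmass_ge0.
have w0 := lp_rmass_ge0 m_gt0 p (cavg m b f).
move: (lp_rmass m p f) (lp_rmass m p (cavg m b f)) f0 fs h2 w0 => u w u0 uw h2 w0.
have h3 : u <= A * w by apply: le_trans h2 _; rewrite ler_wpM2r// lerDl.
have : A * w <= u / 2.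
  have -> : u / 2 = A * (1 / (2 * A) * u) by field; rewrite gt_eqF.
  by rewrite ler_wpM2l// ltW.
by move=> /(le_trans h3); rewrite leNgt ltr_pdivrMr// ltr_pMr// ltr1n.
Qed.

End NotInvertible.

(** * Volume growth *)

Section Growth.
Variable R : realType.
Variables (X : countType) (m : X -> R) (G : graph m).
Hypothesis m_gt0 : forall x, 0 < m x.
Hypothesis m_eq_deg : forall x, (m x)%:E = deg G x.
Hypothesis alpha : cheeger_infty G = 1%:E.

Local Notation b := (edge_weight G).

Lemma graph_dist_path x y (s : seq X) :
  path (adj G) x s -> last x s = y -> (graph_dist G x y <= (size s)%:R%:E)%E.
Proof. by move=> ps ls; apply: ereal_inf_lbound; exists s. Qed.

Lemma short_path x y (r : R) : (graph_dist G x y < r%:E)%E ->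
  exists2 s, path (adj G) x s /\ last x s = y & (size s)%:R < r.
Proof.
by move=> /ereal_inf_lt[_ [s [ps ls] <-]]; rewrite lte_fin => sr; exists s.
Qed.

Lemma ball_path x y n : graph_ball G x n%:R y ->
  exists2 s, path (adj G) x s /\ last x s = y & (size s <= n)%N.
Proof.
move=> xy; have : (graph_dist G x y < n.+1%:R%:E)%E.
  by apply: le_lt_trans xy _; rewrite lte_fin ltr_nat.
by move=> /short_path[s ps]; rewrite ltr_nat ltnS => sn; exists s.
Qed.

Lemma ball_step x y z n : graph_ball G x n%:R y -> 0 < b y z ->
  graph_ball G x n.+1%:R z.
Proof.
move=> /ball_path[s [ps ls] sn] yz.
apply: (@le_trans _ _ (size (rcons s z))%:R%:E).
  by apply: graph_dist_path; rewrite ?last_rcons// rcons_path ps ls.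
by rewrite lee_fin ler_nat size_rcons.
Qed.

Lemma ball_le x (r r' : R) : r <= r' -> graph_ball G x r `<=` graph_ball G x r'.
Proof. by move=> rr y xy; apply: le_trans xy _; rewrite lee_fin. Qed.

Lemma component_ball x y : component G x y -> exists n : nat, graph_ball G x n%:R y.
Proof.
rewrite /component /= => /ereal_inf_lt[_ [s [ps ls] <-] _].
by exists (size s); exact: graph_dist_path ps ls.
Qed.

Lemma le_deg_vol (A B : set X) : A `<=` B -> (deg_vol G A <= deg_vol G B)%E.
Proof.
move=> AB; rewrite /deg_vol esum_mkcond [leRHS]esum_mkcond.
apply: le_esum => x _; case: ifPn => [/set_mem/AB/mem_set ->//|_].
by case: ifP => // _; rewrite -m_eq_deg lee_fin ltW.
Qed.

Section Rooted.
Variables (x0 : X) (K : seq X).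

Definition outer (n : nat) (y : X) : R :=
  if `[< graph_ball G x0 n%:R y >] && (y \notin K) then 1 else 0.

Lemma outer_ge0 n y : 0 <= outer n y.
Proof. by rewrite /outer; case: ifP. Qed.

Definition outer_vol (n : nat) : \bar R := tsum (fun y => outer n y * m y).

Definition core_vol : R := \sum_(x <- undup K) m x.

Lemma core_volE : tsum (fun y => (y \in K)%:R * m y) = core_vol%:E.
Proof.
rewrite (tsum_finite (s := undup K)) ?undup_uniq//.
- congr _%:E; apply: eq_big_seq => y; rewrite mem_undup => ->; exact: mul1r.
- by move=> y; rewrite mulr_ge0// ltW.
- by move=> y; rewrite mem_undup => /negbTE ->; exact: mul0r.
Qed.

Lemma deg_vol_ballE n :
  deg_vol G (graph_ball G x0 n%:R) =
  tsum (fun y => (`[< graph_ball G x0 n%:R y >])%:R * m y).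
Proof.
rewrite /deg_vol esum_mkcond; apply: eq_esum => y _.
case: ifPn => [/set_mem h|/negP h]; first by rewrite -m_eq_deg asboolT// mul1r.
by rewrite asboolF ?mul0r// => h'; apply: h; exact: mem_set.
Qed.

Lemma outer_vol_le n : (outer_vol n <= deg_vol G (graph_ball G x0 n%:R))%E.
Proof.
rewrite deg_vol_ballE; apply: le_tsum => y; rewrite ler_wpM2r ?(ltW (m_gt0 y))//.
by rewrite /outer; case: `[< _ >] => //=; case: ifP.
Qed.

Lemma ball_vol_le n :
  (deg_vol G (graph_ball G x0 n%:R) <= outer_vol n + core_vol%:E)%E.
Proof.
rewrite deg_vol_ballE -core_volE -tsumD => [|y|y]; last 2 first.
- by rewrite mulr_ge0 ?outer_ge0// ltW.
- by rewrite mulr_ge0// ltW.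
apply: le_tsum => y; rewrite -mulrDl ler_wpM2r ?(ltW (m_gt0 y))// /outer.
by case: `[< _ >]; case: (y \in K) => /=; rewrite ?addr0 ?add0r.
Qed.

Lemma outer_monotone n n' : (n <= n')%N -> (outer_vol n <= outer_vol n')%E.
Proof.
move=> nn; apply: le_tsum => y; rewrite ler_wpM2r ?(ltW (m_gt0 y))// /outer.
case: asboolP => //= h; last by case: ifP.
by rewrite asboolT//; apply: (ball_le _ h); rewrite ler_nat.
Qed.

(** All edges from the ball of radius [n] end in the ball of radius [n + 1]. Those
    ending in [K] have at most the volume of [K], and the others run inside
    the outer part of the larger ball, where the co-area inequality applies. *)
Lemma outer_step eta n : coarea_bound m (compress (fun x => x \notin K) b) eta ->
  (outer_vol n <= core_vol%:E + eta%:E * outer_vol n.+1)%E.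
Proof.
move=> co; set D := (fun x => _) in co.
have bm := graph_sub_markov m_eq_deg; have b0 := edge_weight_ge0 G.
have compress0 x y : 0 <= compress D b x y by rewrite /compress; case: ifP.
have min0 y z : 0 <= Num.min (outer n.+1 y) (outer n.+1 z).
  by rewrite le_min !outer_ge0.
apply: (@le_trans _ _ (\esum_(y in [set: X])
  (tsum (fun z => b y z * (z \in K)%:R)%R +
   tsum (fun z => compress D b y z * Num.min (outer n.+1 y) (outer n.+1 z))%R))%E).
  apply: le_esum => y _; rewrite -tsumD => [|z|z]; try by rewrite mulr_ge0.
  rewrite EFinM -(tsum_edge m_eq_deg) -tsumZ ?outer_ge0//.
  apply: le_tsum => z; rewrite {1}/outer.
  case: ifPn => [/andP[/asboolP yn yK]|_]; last first.
    by rewrite mul0r addr_ge0// mulr_ge0.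
  rewrite mul1r; have [zK|zK] := boolP (z \in K).
    by rewrite mulr1 lerDl mulr_ge0.
  rewrite mulr0 add0r /compress /D yK zK /=.
  have := b0 y z; rewrite le_eqVlt => /predU1P[<-|yz]; first by rewrite mul0r.
  rewrite /outer yK zK !asboolT/= ?minxx ?mulr1//.
    exact: ball_step yn yz.
  by apply: (ball_le _ yn); rewrite ler_nat.
rewrite esumD => [|y _|y _]; try by apply: tsum_ge0 => z; rewrite mulr_ge0.
apply: leeD; last exact: co (outer_ge0 _).
rewrite -core_volE.
exact: (kernel_col_sum bm (g := fun z => (z \in K)%:R)).
Qed.

Lemma outer_unbounded T : deg_vol G (component G x0) = +oo%E ->
  exists n, (T%:E <= outer_vol n)%E.
Proof.
move=> voo; have : ((T + core_vol)%:E < deg_vol G (component G x0))%E.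
  by rewrite voo ltry.
move=> /ereal_sup_gt[_ [F [fF FC] <-]] TF.
have [n nF] : exists n : nat, forall y, y \in finmap.enum_fset (fset_set F) ->
    graph_ball G x0 n%:R y.
  have : forall y, y \in finmap.enum_fset (fset_set F) -> component G x0 y.
    by move=> y; rewrite in_fset_set// => /set_mem /FC.
  elim: (finmap.enum_fset _) => [|y s IH] sC; first by exists 0%N.
  have [|n1 h1] := IH; first by move=> z zs; apply: sC; rewrite inE zs orbT.
  have [n2 h2] := component_ball (sC y (mem_head _ _)).
  exists (maxn n1 n2) => z; rewrite inE => /predU1P[->|/h1 h].
    by apply: (ball_le _ h2); rewrite ler_nat leq_maxr.
  by apply: (ball_le _ h); rewrite ler_nat leq_maxl.
exists n; have FB : (\sum_(x \in F) deg G x <= deg_vol G (graph_ball G x0 n%:R))%E.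
  apply: ereal_sup_ubound; exists F => //; split => // y Fy.
  by apply: nF; rewrite in_fset_set// mem_set.
have := lt_le_trans TF (le_trans FB (ball_vol_le n)).
case E : (outer_vol n) => [u| |].
- by rewrite -EFinD lte_fin lee_fin => /ltW; rewrite lerD2r.
- by move=> _; rewrite leey.
- by rewrite addNye ltNge leNye.
Qed.

Lemma outer_vol_ge0 n : (0 <= outer_vol n)%E.
Proof. by apply: tsum_ge0 => y; rewrite mulr_ge0 ?outer_ge0// ltW. Qed.

(** Once the outer volume exceeds twice the core volume, the core term of
    [outer_step] can be absorbed, and each step multiplies the volume by at
    least [1 / (2 eta)]. *)
Lemma outer_growth eta : 0 < eta ->
  coarea_bound m (compress (fun x => x \notin K) b) eta ->
  deg_vol G (component G x0) = +oo%E ->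
  exists n0, forall n, (((2 * eta)^-1 ^+ n)%:E <= outer_vol (n0 + n))%E.
Proof.
move=> e0 co voo.
have [n0 hn0] := outer_unbounded (Num.max 1 (2 * core_vol)) voo.
exists n0; elim=> [|n IH].
  rewrite expr0 addn0; apply: le_trans hn0.
  by rewrite lee_fin le_max lexx.
have hn : ((Num.max 1 (2 * core_vol))%:E <= outer_vol (n0 + n))%E.
  by apply: le_trans hn0 _; apply: outer_monotone; exact: leq_addr.
have step := outer_step (n0 + n) co; rewrite addnS.
have mono := outer_monotone (leqnSn (n0 + n)).
have := outer_vol_ge0 (n0 + n).
move: IH hn step mono; case: (outer_vol (n0 + n).+1) => [u| |]; last 2 first.
- by move=> *; rewrite leey.
- by move=> _ _ _; rewrite leeNy_eq => /eqP ->.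
case: (outer_vol (n0 + n)) => [v| |]//.
rewrite -EFinM -EFinD !lee_fin ge_max => IH /andP[_ kv] step _ v0.
have uv : v <= 2 * eta * u.
  have -> : 2 * eta * u = 2 * (eta * u) by rewrite mulrA.
  move: kv step; move: (eta * u) core_vol => w k; lra.
rewrite exprS ler_pdivrMl ?mulr_gt0//; exact: le_trans IH uv.
Qed.

End Rooted.

(** Taking [eta] so that [1 / (2 eta)] is [expR A]. *)
Lemma ball_lower_bound x0 A : deg_vol G (component G x0) = +oo%E ->
  exists n0 : nat, forall n : nat,
    ((expR (A * n%:R))%:E <= deg_vol G (graph_ball G x0 (n0 + n)%:R))%E.
Proof.
move=> voo; pose eta := expR (- A) / 2.
have e0 : 0 < eta by rewrite divr_gt0// expR_gt0.
have [K co] := coarea_outside_finite m_gt0 m_eq_deg e0 alpha.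
have [n0 h] := outer_growth e0 co voo; exists n0 => n.
apply: le_trans (outer_vol_le x0 K _); apply: le_trans (h n).
have -> : 2 * eta = (expR A)^-1 by rewrite /eta mulrCA divff// mulr1 expRN.
by rewrite invrK expRM_natr.
Qed.

Lemma superexponential_growth x0 : deg_vol G (component G x0) = +oo%E ->
  ((r^-1)%:E * lne (deg_vol G (graph_ball G x0 r)))%E @[r --> +oo%R]
    --> +oo%E.
Proof.
move=> voo; apply/cvgeyPge => A.
have [n0 h] := ball_lower_bound (2 * (`|A| + 1)) voo.
near=> r.
have r0 : 0 < r by near: r; exact: nbhs_pinfty_gt.
have rn : 2 * (n0%:R + 1) <= r by near: r; apply: nbhs_pinfty_ge; rewrite num_real.
have /andP[tr rt] := truncn_itv (ltW r0).
set N := Num.truncn r in tr rt.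
have nN : (n0 <= N)%N.
  rewrite -ltnS -(ltr_nat R); apply: le_lt_trans rt; apply: le_trans rn.
  have : (0 : R) <= n0%:R by []. 
  lra.
have low : ((expR (2 * (`|A| + 1) * (N - n0)%:R))%:E <=
    deg_vol G (graph_ball G x0 r))%E.
  apply: le_trans (h (N - n0)%N) _; rewrite subnKC//.
  by apply: le_deg_vol; exact: ball_le.
have : (lne (expR (2 * (`|A| + 1) * (N - n0)%:R))%:E <=
    lne (deg_vol G (graph_ball G x0 r)))%E.
  rewrite lee_lne// ?in_itv/= ?lee_fin ?expR_ge0 ?leey//.
  by rewrite (le_trans _ low)// lee_fin expR_ge0.
rewrite lne_EFin ?expR_gt0// expRK => low2.
apply: le_trans (lee_wpmul2l _ low2); last by rewrite lee_fin invr_ge0 ltW.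
rewrite -EFinM lee_fin mulrC ler_pdivlMr// natrB//.
rewrite -natr1 in rt.
have A0 : A <= `|A| + 1 by rewrite (le_trans (ler_norm A))// lerDl.
have B0 : 0 <= `|A| + 1 by rewrite addr_ge0.
move: (`|A| + 1) A0 B0 => B A0 B0.
apply: (@le_trans _ _ (B * r)); first by rewrite ler_wpM2r// ltW.
rewrite mulrC (mulrC 2) -mulrA mulrC ler_wpM2l//.
have : (0 : R) <= n0%:R by [].
move: (n0%:R) (N%:R) rn rt => a c rn rt a0; lra.
Unshelve. all: by end_near. Qed.

End Growth.

Unset Implicit Arguments.
Set Strict Implicit.

Theorem theorem6p4 (R : realType) (X : countType) (m : X -> R) (G : graph m)
    (m_gt0 : forall x : X, 0 < m x)
    (neighbour : forall x : X, exists y : X, adj G x y)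
    (m_eq_deg : forall x : X, (m x)%:E = deg G x)
    (c_eq0 : forall x : X, killing G x = 0)
    (alpha_eq1 : cheeger_infty G = 1%:E) :
  (forall p : R, 1 < p -> laplacian_spectrum G p = laplacian_spectrum G 2) /\
  (forall x : X, deg_vol G (component G x) = +oo%E ->
     ((r^-1)%:E * lne (deg_vol G (graph_ball G x r)))%E @[r --> +oo%R]
       --> (+oo)%E).
Proof.
split; last exact: superexponential_growth.
have sub p r z : 1 < p -> 1 < r -> resolvent_set m p (laplacian G) z ->
    resolvent_set m r (laplacian G) z.
  move=> p1 r1 res; have [inj surj] := resolvent_bijective m_gt0 m_eq_deg c_eq0 p1 res.
  have [z1|z1] := eqVneq (1 - z) 0.
    case: (one_notin_resolvent_set m_gt0 m_eq_deg alpha_eq1 c_eq0 p1).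
    by move: z1 res => /eqP; rewrite subr_eq0 => /eqP <-.
  have [inj' [M surj']] := bijective_transfer m_gt0 m_eq_deg alpha_eq1 p1 r1 z1 inj surj.
  exact: bijective_resolvent inj' surj'.
move=> p p1; rewrite /laplacian_spectrum /spectrum; congr (~` _).
by apply/seteqP; split=> z; apply: sub => //; rewrite ltr1n.
Qed.
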